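(* Let $p,q\ge1$ and $1\le k\le\min(p,q)$. For each $\alpha\vdash p$ decompose the irreducible module $S^\alpha$ under $S_{p-k}$ as $$S^\alpha\downarrow_{S_{p-k}}=\bigoplus_{\gamma\vdash p-k}S^\gamma\otimes M_{\alpha/\gamma},$$ with multiplicity spaces $M_{\alpha/\gamma}$, and similarly decompose $S^\beta\downarrow_{S_{q-k}}$ for $\beta\vdash q$. Call a positive element $X\in\mathbb C[S_p]$ compressed if for every $\alpha\vdash p$ its action on $S^\alpha$ has the form $$X_\alpha=\bigoplus_{\gamma\vdash p-k}I_{S^\gamma}\otimes X_{\alpha/\gamma},\qquad X_{\alpha/\gamma}\succeq0\text{ on }M_{\alpha/\gamma},$$ and define compressed positive elements $Y\in\mathbb C[S_q]$ in the same way, with $S_{q-k}$ in place of $S_{p-k}$. Then: (1) For all positive $X\in\mathbb C[S_p]$ and $Y\in\mathbb C[S_q]$ there are compressed positive $X'\in\mathbb C[S_p]$ and $Y'\in\mathbb C[S_q]$ giving the same partial-swap coefficient vector, $t_\nu(X',Y')=t_\nu(X,Y)$ for all $\nu\vdash p+q$. (2) $\dim M_{\alpha/\gamma}=f^{\alpha/\gamma}\le k!$ for all $\alpha\vdash p$ and $\gamma\vdash p-k$ (and likewise in the other block), where $f^{\alpha/\gamma}$ is the number of standard Young tableaux of skew shape $\alpha/\gamma$ (zero if $\gamma\not\subset\alpha$). (3) The convex cone generated by all partial-swap coefficient vectors $(t_\nu(X,Y))_{\nu\vdash p+q}$, with $X\in\mathbb C[S_p]$ and $Y\in\mathbb C[S_q]$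 positive, is generated by those with $X,Y$ compressed and such that, for a single pair $(\alpha,\beta)$ with $\alpha\vdash p$, $\beta\vdash q$ and a single pair of predecessors $(\gamma,\delta)$ with $\gamma\vdash p-k$, $\delta\vdash q-k$, the only nonzero multiplicity block of $X$ is $X_{\alpha/\gamma}$, the only nonzero multiplicity block of $Y$ is $Y_{\beta/\delta}$, and both of these are rank-one positive-semidefinite matrices.
   Context: For $\nu\vdash n$, $S^\nu$ is the irreducible complex (unitary) $S_n$-module. $\mathbb C[S_n]$ is regarded as a $C^*$-algebra with conjugate-linear involution $\sigma^*=\sigma^{-1}$; an element is positive if it is of the form $aa^*$, equivalently if it acts as a positive-semidefinite operator in every irreducible unitary representation. $S_p\times S_q\subset S_{p+q}$ acts on two blocks of positions of sizes $p$ and $q$; the last $k$ positions of each block are marked. The subgroup $S_{p-k}\subset S_p$ (respectively $S_{q-k}\subset S_q$) permutes the unmarked positions of the first (respectively second) block. The permutation $\tau_k\in S_{p+q}$ is the product of $k$ disjoint transpositions pairing the marked positions of the first block with those of the second block in order. For $X\in\mathbb C[S_p]$, $Y\in\mathbb C[S_q]$, the partial-swap coefficient vector is $t_\nu(X,Y)=\operatorname{Tr}_{S^\nu}\bigl(\tau_k(X\otimes Y)\bigr)$, $\nu\vdash p+q$; for $X=aa^*$, $Y=bb^*$ this equals $\operatorname{Tr}_{S^\nu}\bigl((a\otimes b)^*\tau_k(a\otimes b)\bigr)$. *)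

(* Defs.v *)
From HB Require Import structures.
From mathcomp Require Import all_boot all_order all_algebra all_fingroup.
From mathcomp Require Import all_character.
From mathcomp Require Import spectral.

Set Implicit Arguments.
Unset Strict Implicit.
Unset Printing Implicit Defensive.

Import GroupScope Order.TTheory GRing.Theory Num.Theory.
Local Open Scope ring_scope.
Local Open Scope sesquilinear_scope.

(** * Partitions and skew standard tableaux *)

Definition is_part (n : nat) (s : seq nat) : bool :=
  [&& sorted geq s, 0%N \notin s & sumn s == n].

Record part (n : nat) := Part { part_val :> seq nat; _ : is_part n part_val }.

HB.instance Definition _ n := [isSub for @part_val n].
HB.instance Definition _ n := [Countable of part n by <:].

Definition part_incl (s t : seq nat) : bool :=
  all (fun i => nth 0%N s i <= nth 0%N t i)%N (iota 0 (size s)).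

(* The diagram of a partition of n fits in the n x n box, so cells are pairs of
   ordinals (row, column), counted from 0. *)
Definition in_skew n m (al : part n) (ga : part m) (c : 'I_n * 'I_n) : bool :=
  (nth 0 ga c.1 <= c.2 < nth 0 al c.1)%N.

Definition skew_cell n m (al : part n) (ga : part m) : finType :=
  {c : 'I_n * 'I_n | in_skew al ga c}.

(* Fillings by 0, ..., N - 1 with N the number of cells, each used once. *)
Definition is_syt n m (al : part n) (ga : part m)
    (T : {ffun skew_cell al ga -> 'I_#|skew_cell al ga|}) : bool :=
  [&& injectiveb T,
      [forall c : skew_cell al ga, forall d : skew_cell al ga,
         ((sval c).1 == (sval d).1) && ((sval c).2 < (sval d).2)%N ==> (T c < T d)%N]
    & [forall c : skew_cell al ga, forall d : skew_cell al ga,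
         ((sval c).2 == (sval d).2) && ((sval c).1 < (sval d).1)%N ==> (T c < T d)%N]].

Definition nb_skew_syt n m (al : part n) (ga : part m) : nat :=
  if part_incl ga al then #|[set T | @is_syt n m al ga T]| else 0%N.

(** * Group algebras

   Permutations are multiplied as in the library, (s * t) x = t (s x), and
   modules consist of row vectors on which the group acts on the right; these
   are the left modules of the group with the law (s o t) x = s (t x).  The
   products below are therefore read in the reverse order of the usual
   left-module notation; this affects neither positivity nor the traces.

   The scalars are an arbitrary [numClosedFieldType], such as the field R[i]
   of complex numbers; 0 <= z implies there that z is real. *)

Section GroupAlgebra.
Variable C : numClosedFieldType.

Definition galg (n : nat) : Type := {ffun 'S_n -> C}.

Definition gdelta n (s : 'S_n) : galg n := [ffun g => (g == s)%:R].

Definition gmul n (a b : galg n) : galg n :=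
  [ffun g => \sum_(h : 'S_n) a h * b (h^-1 * g)%g].

Definition gstar n (a : galg n) : galg n := [ffun g => (a g^-1%g)^*].

Definition gpos n (x : galg n) : Prop := exists a : galg n, x = gmul a (gstar a).

(** * Specht modules *)

(* The tableau of shape nu filled in row-reading order: entry x lies in row
   [reshape_index nu x] and column [reshape_offset nu x]. *)
Definition row_stab n (nu : part n) : {set 'S_n} :=
  [set s : 'S_n | [forall x : 'I_n, reshape_index nu (s x) == reshape_index nu x]].

Definition col_stab n (nu : part n) : {set 'S_n} :=
  [set s : 'S_n | [forall x : 'I_n, reshape_offset nu (s x) == reshape_offset nu x]].

Definition row_sum n (nu : part n) : galg n :=
  [ffun s => (s \in row_stab nu)%:R].

Definition col_sum n (nu : part n) : galg n :=
  [ffun s => if s \in col_stab nu then (-1) ^+ odd_perm s else 0].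

Definition young_symmetrizer n (nu : part n) : galg n :=
  gmul (row_sum nu) (col_sum nu).

Definition sym_regular n : mx_representation C [set: 'S_n] #|[set: 'S_n]| :=
  regular_repr C [set: 'S_n].

Definition grow n (a : galg n) : 'rV[C]_#|[set: 'S_n]| :=
  \row_i a (enum_val i).

(* The ideal generated by the Young symmetrizer, that is, the span of the
   polytabloids, as a row space. *)
Definition specht_sp n (nu : part n) : 'M[C]_#|[set: 'S_n]| :=
  cyclic_mx (sym_regular n) (grow (young_symmetrizer nu)).

Definition specht_dim n (nu : part n) : nat := \rank (specht_sp nu).

(* An orthonormal basis for the invariant Hermitian form that makes the group
   elements orthonormal in the group algebra. *)
Definition specht_basis n (nu : part n) :
    'M[C]_(specht_dim nu, #|[set: 'S_n]|) :=
  schmidt (row_base (specht_sp nu)).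

Definition specht_mx n (nu : part n) (s : 'S_n) : 'M[C]_(specht_dim nu) :=
  specht_basis nu *m sym_regular n s *m (specht_basis nu) ^t*.

Lemma specht_basis_unitary n (nu : part n) : specht_basis nu \is unitarymx.
Proof. by apply: schmidt_unitarymx; apply: rank_leq_col. Qed.

Lemma specht_basis_eq n (nu : part n) :
  (specht_basis nu :=: specht_sp nu)%MS.
Proof.
apply: eqmx_trans (eq_row_base _).
by apply: eqmx_schmidt_free; apply: row_base_free.
Qed.

Lemma specht_mx_repr n (nu : part n) : mx_repr [set: 'S_n] (specht_mx nu).
Proof.
have /unitarymxP BB := specht_basis_unitary nu.
split=> [|s t _ _]; first by rewrite /specht_mx repr_mx1 mulmx1.
have /submxP[D eD] : (specht_basis nu *m sym_regular n s <= specht_basis nu)%MS.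
  rewrite (eqmxMr _ (specht_basis_eq nu)) (specht_basis_eq nu).
  by apply: (mxmoduleP (cyclic_mx_module _ _)); rewrite inE.
rewrite /specht_mx repr_mxM ?inE // !mulmxA eD; congr (_ *m _ *m _).
by rewrite -(mulmxA D) BB mulmx1.
Qed.

Definition specht n (nu : part n) :
    mx_representation C [set: 'S_n] (specht_dim nu) :=
  MxRepresentation (specht_mx_repr nu).

Lemma sym_regular_unitary n (s : 'S_n) : sym_regular n s \is unitarymx.
Proof.
apply/unitarymxP/matrixP=> i j; rewrite !mxE.
rewrite (bigD1 (gring_index [set: 'S_n] (enum_val i * s)%g)) //= big1 => [|k ki].
  rewrite !mxE !eqxx /= mul1r addr0.
  rewrite (can_in_eq (@gring_indexK _ [set: 'S_n]%G)) ?inE //.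
  by rewrite (inj_eq (mulIg s)) (inj_eq enum_val_inj) rmorph_nat.
by rewrite !mxE (negPf ki) andbF mul0r.
Qed.

Lemma specht_unitary n (nu : part n) (s : 'S_n) : specht nu s \is unitarymx.
Proof.
have /unitarymxP BB := specht_basis_unitary nu.
have /unitarymxP RR := sym_regular_unitary s.
have /submxP[D eD] : (specht_basis nu *m sym_regular n s <= specht_basis nu)%MS.
  rewrite (eqmxMr _ (specht_basis_eq nu)) (specht_basis_eq nu).
  by apply: (mxmoduleP (cyclic_mx_module _ _)); rewrite inE.
apply/unitarymxP; rewrite /= /specht_mx !trmx_mul !map_mxM /= map_trmx trmxK.
rewrite -map_mx_comp (map_mx_id (@conjCK C)) !mulmxA {1}eD.
by rewrite -(mulmxA D) BB mulmx1 -eD -(mulmxA (specht_basis nu)) RR mulmx1.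
Qed.

Definition galg_op n (nu : part n) (x : galg n) : 'M[C]_(specht_dim nu) :=
  \sum_(s : 'S_n) x s *: specht nu s.

(** * Blocks of positions and the partial swap *)

Definition sum_perm_fun p q (s : 'S_p) (t : 'S_q) (x : 'I_(p + q)) :
    'I_(p + q) :=
  match split x with inl i => lshift q (s i) | inr j => rshift p (t j) end.

Lemma sum_perm_inj p q (s : 'S_p) (t : 'S_q) : injective (sum_perm_fun s t).
Proof.
move=> x y; rewrite /sum_perm_fun.
case: (splitP x) => i xi; case: (splitP y) => j yj /(congr1 val) /= e;
  apply: val_inj; rewrite /= xi yj.
- by rewrite (perm_inj (val_inj e)).
- by have := ltn_ord (s i); rewrite e ltnNge leq_addr.
- by have := ltn_ord (s j); rewrite -e ltnNge leq_addr.
- by move/addnI: e => e; rewrite (perm_inj (val_inj e)).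
Qed.

Definition sum_perm p q (s : 'S_p) (t : 'S_q) : 'S_(p + q) :=
  perm (@sum_perm_inj p q s t).

Definition gtens p q (X : galg p) (Y : galg q) : galg (p + q) :=
  [ffun g => \sum_(st : 'S_p * 'S_q | sum_perm st.1 st.2 == g)
     X st.1 * Y st.2].

(* The inclusion of S_(n - k) in S_n, fixing the last k positions. *)
Definition unmarked_perm k n (kn : (k <= n)%N) (s : 'S_(n - k)) : 'S_n :=
  cast_perm (subnK kn) (sum_perm s (1%g : 'S_k)).

Definition marked k n (kn : (k <= n)%N) (i : 'I_k) : 'I_n :=
  cast_ord (subnK kn) (rshift (n - k) i).

Definition partial_swap k p q (kp : (k <= p)%N) (kq : (k <= q)%N) :
    'S_(p + q) :=
  (\prod_(i < k) tperm (lshift q (marked kp i)) (rshift p (marked kq i)))%g.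

Definition swap_coef k p q (kp : (k <= p)%N) (kq : (k <= q)%N)
    (X : galg p) (Y : galg q) (nu : part (p + q)) : C :=
  \tr (galg_op nu (gmul (gdelta (partial_swap kp kq)) (gtens X Y))).

(** * Multiplicity spaces *)

(* The multiplicity space of S^ga in the restriction of S^al is the space of
   S_(n - k)-equivariant maps S^ga -> S^al; the canonical map sends v (x) phi
   to v *m phi. *)
Definition mult_sp k n (kn : (k <= n)%N) (al : part n) (ga : part (n - k)) :
    {vspace 'M[C]_(specht_dim ga, specht_dim al)} :=
  (\bigcap_(s : 'S_(n - k))
     lker (linfun (mulmx (specht ga s))
           - linfun (mulmxr (specht al (unmarked_perm kn s)))))%VS.

Definition mult k n (kn : (k <= n)%N) (al : part n) (ga : part (n - k)) :
    vectType C :=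
  subvs_of (mult_sp kn al ga).

(* By Schur's lemma phi *m psi ^t* is the scalar matrix <phi, psi>, for the
   form on the multiplicity space that makes v (x) phi |-> v *m phi isometric.
   The trace is a positive multiple of this form. *)
Definition mult_form k n (kn : (k <= n)%N) (al : part n) (ga : part (n - k))
    (phi psi : mult kn al ga) : C :=
  \tr (vsval phi *m (vsval psi) ^t*).

Definition mult_psd k n (kn : (k <= n)%N) (al : part n) (ga : part (n - k))
    (A : 'End(mult kn al ga)) : Prop :=
  forall phi, 0 <= mult_form (A phi) phi.

Definition mult_blocks k n (kn : (k <= n)%N) : Type :=
  forall (al : part n) (ga : part (n - k)), 'End(mult kn al ga).

(* X acts on each S^al as the direct sum of the operators I (x) B al ga:
   under v (x) phi |-> v *m phi, v (x) phi is sent to v (x) B al ga phi. *)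
Definition acts_by_blocks k n (kn : (k <= n)%N) (X : galg n)
    (B : mult_blocks kn) : Prop :=
  forall al ga (phi : mult kn al ga) (v : 'rV[C]_(specht_dim ga)),
    v *m vsval phi *m galg_op al X = v *m vsval (B al ga phi).

Definition block_form k n (kn : (k <= n)%N) (X : galg n)
    (B : mult_blocks kn) : Prop :=
  acts_by_blocks X B /\ (forall al ga, mult_psd (B al ga)).

Definition compressed k n (kn : (k <= n)%N) (X : galg n) : Prop :=
  gpos X /\ exists B : mult_blocks kn, block_form X B.

Definition rank_one_compressed k n (kn : (k <= n)%N) (al : part n)
    (ga : part (n - k)) (X : galg n) : Prop :=
  gpos X /\ exists B : mult_blocks kn,
    [/\ block_form X B,
        forall al' ga', (al', ga') != (al, ga) -> B al' ga' = 0
      & \dim (limg (B al ga)) = 1%N].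

End GroupAlgebra.

(** * Convex cones *)

Definition cone_gen (C : numClosedFieldType) (T : Type)
    (A : (T -> C) -> Prop) (v : T -> C) : Prop :=
  exists (m : nat) (c : 'I_m -> C) (w : 'I_m -> T -> C),
    (forall i, 0 <= c i /\ A (w i))
    /\ (forall t, v t = \sum_(i < m) c i * w i t).

(* Main.v *)
Require Import Defs.
From HB Require Import structures.
From mathcomp Require Import all_boot all_order all_algebra all_fingroup.
From mathcomp Require Import all_character.
From mathcomp Require Import spectral zify.

(** For the branching rule, let f(nu) be the dimension of S^nu and g(nu) its
    number of standard tableaux.  Whenever mu is nu minus a box, S^mu occurs in
    S^nu restricted to S_(n-1), because r_nu c_nu r_nu <> 0 for the row and
    column sums; hence f >= g by induction.  Young symmetrizers of distinct
    shapes are orthogonal, so Bessel's inequality for the regular character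
    gives sum f^2 <= n!, while D U = U D + 1 on Young's lattice gives
    sum g^2 = n!.  So f = g, the Specht modules exhaust the irreducible ones,
    and all multiplicities of the restriction are 0 or 1.

    Compression is conjugation averaged over S_(p-k) and S_(q-k): these
    subgroups commute with tau_k, so no trace changes.  If X acts on S^al as
    A A^*, then the regular character of S_(p-k) writes the average of X on
    S^al as a nonnegative combination of operators phi^* phi, with phi running
    over intertwiners S^ga -> S^al; each of them is a rank one operator of the
    multiplicity space by Schur's lemma. *)

Set Implicit Arguments.
Unset Strict Implicit.
Unset Printing Implicit Defensive.

Import Order.TTheory GRing.Theory Num.Theory.

(** * Partitions and Young's lattice *)

(** The computations rest on traces of maps x |-> a x b on the group algebra. With the Young
    idempotents E, the character of S^nu at s is the trace of x |-> E_nu x s, and the multiplicity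
    of S^ga in S^al is the trace of x |-> E_al x E_ga. The latter map is idempotent, so its trace is
    its rank: a natural number that vanishes only with the map, and a single nonzero product bounds
    it below by 1. Schur's lemma is read off from character orthogonality in the same way, as the
    rank of an averaging projection. That the Specht modules exhaust the irreducible ones is used
    again for Fourier inversion: an element of the group algebra is determined by its blocks on the
    S^al and can be built from prescribed blocks, so positivity is tested block by block. For k > 1,
    restriction in stages iterates the one box rule, in parallel with the recursion that erases the
    largest entry of a skew tableau; the bound k! counts all bijective fillings of k cells. *)

Lemma part_sorted n (nu : part n) i j : i <= j -> nth 0 nu j <= nth 0 nu i.
Proof.
case: nu => s /= /and3P[ss _ _] ij.
have [js|js] := ltnP j (size s); last by rewrite nth_default.
have tr : transitive geq by move=> a b c /= ba cb; apply: leq_trans cb ba.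
exact: (sorted_leq_nth tr leqnn 0 ss _ _ (leq_ltn_trans ij js) js).
Qed.

Lemma size_part n (nu : part n) : size nu <= n.
Proof.
case: nu => s /= /and3P[_ s0 /eqP <-].
elim: s s0 => //= x s IH; rewrite in_cons negb_or => /andP[x0 /IH]; lia.
Qed.

Lemma sum_nth K s : size s <= K -> \sum_(i < K) nth 0 s i = sumn s.
Proof.
elim: s K => [|x s IH] [|K] //= sK; first by rewrite big_ord0.
  by rewrite big1 // => i _; rewrite nth_nil.
by rewrite big_ord_recl /= IH.
Qed.

Lemma sum_part K n (nu : part n) : n <= K -> \sum_(i < K) nth 0 nu i = n.
Proof.
move=> nK; rewrite sum_nth ?(leq_trans (size_part nu)) //.
by case: nu => s /= /and3P[_ _ /eqP].
Qed.

Lemma part_le n (nu : part n) i : nth 0 nu i <= n.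
Proof.
have [ni|ni] := leqP n i; first by rewrite nth_default ?(leq_trans (size_part _)).
by rewrite -{2}(sum_part nu (leqnn n)) (bigD1 (Ordinal ni)) //= leq_addr.
Qed.

Lemma part_nth0 n (nu : part n) i : n <= i -> nth 0 nu i = 0.
Proof. by move=> ni; rewrite nth_default ?(leq_trans (size_part _)). Qed.

Lemma filter_nth_part n (nu : part n) K : n <= K ->
  filter (predC1 0) (mkseq (nth 0 nu) K) = nu.
Proof.
move=> nK; have sK := leq_trans (size_part nu) nK.
have -> : mkseq (nth 0 nu) K = nu ++ nseq (K - size nu) 0.
  apply: (@eq_from_nth _ 0) => [|i].
    by rewrite size_mkseq size_cat size_nseq subnKC.
  rewrite size_mkseq => iK; rewrite nth_mkseq // nth_cat nth_nseq.
  case: ltnP => // h; rewrite nth_default //; by case: ifP.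
rewrite filter_cat (_ : filter _ (nseq _ _) = [::]) ?cats0.
  apply/all_filterP/allP => x xs /=; case: nu xs {sK} => s /= /and3P[_ s0 _] xs.
  by apply: contraNneq s0 => <-.
by apply/eqP; rewrite -[_ == _]negbK -has_filter has_nseq /= andbF.
Qed.

Lemma part_ext n (nu mu : part n) :
  (forall i, i < n -> nth 0 nu i = nth 0 mu i) -> nu = mu.
Proof.
move=> e; apply: val_inj; rewrite /= -(filter_nth_part nu (leqnn n)).
rewrite -(filter_nth_part mu (leqnn n)); congr filter.
by apply/eq_in_map => i; rewrite mem_iota => /e.
Qed.

Lemma part_make K n (f : nat -> nat) :
    (forall i, f i.+1 <= f i) -> (forall i, K <= i -> f i = 0) ->
    \sum_(i < K) f i = n ->
  exists nu : part n, forall i, nth 0 nu i = f i.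
Proof.
move=> fa f0 fs; set s := filter (predC1 0) (mkseq f K).
have fa' i j : i <= j -> f j <= f i.
  by elim: j => [|j IH]; [rewrite leqn0 => /eqP-> | rewrite leq_eqVlt => /predU1P[-> //|/IH]; apply: leq_trans].
have nn i (fi : f i = 0) j : i <= j -> f j = 0.
  by move=> /fa'; rewrite fi leqn0 => /eqP.
(* Dropping the zeros does not shift any other entry, because after the first zero all values are
   zero. The statement is generalized over g so that the induction can pass to the shifted
   function. *)
have key : forall (g : nat -> nat) L, (forall i, g i = 0 -> forall j, i <= j -> g j = 0) ->
    (forall i, L <= i -> g i = 0) -> forall i, nth 0 (filter (predC1 0) (mkseq g L)) i = g i.
  move=> g L; elim: L g => [|L IH] g g0 gL i; first by rewrite /= nth_nil gL.
  rewrite /mkseq /= -(addn0 1) iotaDl -map_comp.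
  have [e|ne] /= := eqVneq (g 0) 0.
    have gz x : g x = 0 by apply: (g0 0).
    rewrite gz; set s' := filter _ _; suff -> : s' = [::] by rewrite nth_nil.
    apply/eqP; rewrite -[_ == _]negbK -has_filter; apply/hasPn => x /mapP[y _ ->] /=.
    by rewrite gz.
  case: i => [//|i] /=; rewrite (IH (g \o S)) //= => [j ej k jk|j Lj]; first exact: (g0 j.+1).
  exact: gL.
have gs : is_part n s.
  apply/and3P; split; last 1 first.
  - have sK : size s <= K by rewrite size_filter (leq_trans (count_size _ _)) ?size_mkseq.
    by rewrite -(sum_nth sK) -fs; apply/eqP/eq_bigr => i _; apply: key.
  - apply: sorted_filter; first by move=> a b c /= ba cb; apply: leq_trans cb ba.
    apply/(sortedP 0) => i; rewrite size_mkseq => iK; have iK' := ltnW iK.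
    by rewrite !nth_mkseq //= fa.
  - by rewrite mem_filter.
by exists (Part gs) => i; apply: key.
Qed.

(** Encodes a partition by its first n row lengths, padded with zeros, to make [part n] a finite
    type over which sums can be taken. *)
Definition ffun_of_part n (nu : part n) : {ffun 'I_n -> 'I_n.+1} :=
  [ffun i : 'I_n => inord (nth 0 nu i)].

Definition part_of_ffun n (f : {ffun 'I_n -> 'I_n.+1}) : option (part n) :=
  insub (filter (predC1 0) [seq val (f i) | i <- enum 'I_n]).

Lemma ffun_of_partK n : pcancel (@ffun_of_part n) (@part_of_ffun n).
Proof.
move=> nu; rewrite /part_of_ffun; set s := filter _ _.
have -> : s = nu; last by rewrite valK.
rewrite -[RHS](filter_nth_part nu (leqnn n)); congr filter.
rewrite /mkseq -val_enum_ord -map_comp; apply: eq_map => i /=.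
by rewrite ffunE inordK // ltnS part_le.
Qed.

HB.instance Definition _ n : isFinite (part n) := PCanIsFinite (@ffun_of_partK n).

(** ** Adding and removing boxes *)

(** Shapes are handled as functions from rows to row lengths, so that boxes can be added or removed
    without first proving that the result is a partition. *)
Definition add_box (f : nat -> nat) r := fun i => f i + (i == r).
Definition rem_box (f : nat -> nat) r := fun i => f i - (i == r).
Definition addable (f : nat -> nat) r := (r == 0) || (f r < f r.-1).
Definition removable (f : nat -> nat) r := f r.+1 < f r.

Section UpDown.
Variable K : nat.

(** For a shape with n boxes and at most K rows, this is the number of its standard tableaux: each
    is a way to remove the boxes one at a time. *)
Fixpoint box_paths n (f : nat -> nat) : nat :=
  if n is n'.+1 then \sum_(r < K) removable f r * box_paths n' (rem_box f r)
  else 1.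

Lemma box_pathsS n f : box_paths n.+1 f =
  \sum_(r < K) removable f r * box_paths n (rem_box f r).
Proof. by []. Qed.

Lemma box_paths0 f : box_paths 0 f = 1. Proof. by []. Qed.

Local Arguments box_paths : simpl never.

Lemma eq_box_paths n f g : f =1 g -> box_paths n f = box_paths n g.
Proof.
elim: n f g => // n IH f g e; rewrite !box_pathsS; apply: eq_bigr => r _.
by rewrite /removable !e (IH _ (rem_box g r)) // => i; rewrite /rem_box e.
Qed.

(** Row r + 1 is addable exactly when row r is removable, and row 0 is always addable. The empty row
    K - 1 ensures that nothing is lost at the end of the range. *)
Lemma sum_addable f : 0 < K -> f K.-1 = 0 ->
  \sum_(r < K) addable f r = (\sum_(r < K) removable f r).+1.
Proof.
case: K => // K' _ /= f0; rewrite big_ord_recl big_ord_recr /=.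
by rewrite {2}/removable f0 ltn0 addn0.
Qed.

Lemma addable_removable f i j : i != j ->
  addable f i && removable (add_box f i) j =
  removable f j && addable (rem_box f j) i.
Proof.
rewrite /addable /removable /add_box /rem_box; case: i => [|i] /=; first by lia.
by case: (eqVneq i j) => [->|]; lia.
Qed.

Lemma sum_rem_box f r n : r < K ->
  removable f r -> \sum_(i < K) f i = n.+1 ->
  \sum_(i < K) rem_box f r i = n.
Proof.
move=> rK rr; rewrite (bigD1 (Ordinal rK)) //= => fs.
rewrite (bigD1 (Ordinal rK)) //= {1}/rem_box eqxx.
rewrite (eq_bigr (fun i : 'I_K => f i)) => [|i /negPf]; last first.
  by rewrite -(inj_eq val_inj) /rem_box /= => ->; rewrite subn0.
by move: rr; rewrite /removable; lia.
Qed.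

(* The commutation relation D U = U D + 1 of Young's lattice. *)
Lemma sum_add_box_paths n f : 0 < K -> (forall i, f i.+1 <= f i) ->
    f K.-1 = 0 -> \sum_(i < K) f i = n ->
  \sum_(r < K) addable f r * box_paths n.+1 (add_box f r) = n.+1 * box_paths n f.
Proof.
move=> K0; elim: n f => [|n IH] f fa fK fs.
  have f0 i : f i = 0.
    have : f i <= f 0 by elim: i => // i; apply: leq_trans.
    have /eqP := fs; rewrite (bigD1 (Ordinal K0)) //= addn_eq0 => /andP[/eqP -> _].
    by rewrite leqn0 => /eqP.
  rewrite (bigD1 (Ordinal K0)) //= big1 => [|r]; last first.
    by rewrite -(inj_eq val_inj) /addable !f0 /= => /negPf->.
  rewrite addn0 mul1n box_pathsS (bigD1 (Ordinal K0)) //= big1 => [|r].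
    by rewrite /removable /add_box !f0 !box_paths0.
  by rewrite -(inj_eq val_inj) /removable /add_box !f0 /= => /negPf->.
(* Add a box in row i, then remove one in row j. The diagonal terms return to f, once for each
   addable row; off the diagonal the two operations commute. *)
pose t i j := addable f i * (removable (add_box f i) j *
  box_paths n.+1 (rem_box (add_box f i) j)).
have e1 i : addable f i * box_paths n.+2 (add_box f i) = \sum_(j < K) t i j.
  by rewrite box_pathsS big_distrr.
under eq_bigr do rewrite e1.
have e2 (i : 'I_K) : \sum_(j < K) t i j =
    addable f i * box_paths n.+1 f + \sum_(j < K | j != i) t i j.
  rewrite (bigD1 i) //=; congr (_ + _); rewrite /t; congr (_ * _).
  rewrite /removable /add_box eqxx (gtn_eqF (ltnSn i)) addn0 addn1 ltnS fa mul1n.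
  by apply: eq_box_paths => x; rewrite /rem_box addnK.
under eq_bigr do rewrite e2.
rewrite big_split /= -big_distrl /= sum_addable // (exchange_big_dep predT) //=.
(* Removing and then restoring the box in row j is the diagonal term that completes the induction
   hypothesis for [rem_box f j]. *)
have e3 (j : 'I_K) : \sum_(i < K | j != i) t i j + removable f j * box_paths n.+1 f
   = n.+1 * (removable f j * box_paths n (rem_box f j)).
  case rj : (removable f j); last first.
    rewrite mul0n muln0 addn0 big1 // => i ij; rewrite /t mulnA mulnb.
    by rewrite addable_removable 1?eq_sym // rj.
  rewrite !mul1n -IH; last 3 first.
  - by move=> i; move: rj (fa i); rewrite /removable /rem_box; case: (eqVneq i j) => [->|]; lia.
  - by rewrite /rem_box fK.
  - exact: sum_rem_box.
  rewrite [RHS](bigD1 j) //= addnC; congr (_ + _).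
    rewrite (_ : addable _ _) ?mul1n.
      apply: eq_box_paths => x; rewrite /add_box /rem_box.
      by move: rj; rewrite /removable; case: eqP => [->|]; lia.
    rewrite /addable /rem_box; case: (val j) rj => //= i.
    by move: (fa i); rewrite /removable; lia.
  apply: eq_big => [i|i ij]; first by rewrite eq_sym.
  rewrite /t mulnA mulnb addable_removable 1?eq_sym // rj; congr (_ * _).
  apply: eq_box_paths => x; rewrite /add_box /rem_box.
  by move: ij rj; rewrite -(inj_eq val_inj) /removable /=; lia.
have e4 : \sum_(j < K) \sum_(i < K | j != i) t i j
   + (\sum_(r < K) removable f r) * box_paths n.+1 f = n.+1 * box_paths n.+1 f.
  rewrite big_distrl -big_split [in RHS]/= big_distrr /=.
  by apply: eq_bigr => j _; rewrite -e3; congr (_ + _); apply: eq_bigl => i; rewrite eq_sym.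
(* The excess of one addable row over the removable ones raises the factor from n + 1 to n + 2. *)
by rewrite mulSn -addnA [X in _ + X]addnC e4.
Qed.

End UpDown.

Arguments box_paths : simpl never.

Definition cover_at n (nu : part n.+1) (mu : part n) (r : nat) : bool :=
  [forall i : 'I_n.+1, nth 0 nu i == add_box (nth 0 mu) r i].

Definition covers n (nu : part n.+1) (mu : part n) : bool :=
  [exists r : 'I_n.+1, cover_at nu mu r].

Section Cover.
Variables (n : nat).
Implicit Types (nu : part n.+1) (mu : part n).

(** Testing the first n + 1 rows suffices: r > n would make the row sums n + 1 and n agree, and
    beyond row n both shapes are empty. *)
Lemma cover_atP nu mu r :
  reflect (forall i, nth 0 nu i = add_box (nth 0 mu) r i) (cover_at nu mu r).
Proof.
apply: (iffP forallP) => [e i|e i]; last by rewrite e.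
have rn : r < n.+1.
  rewrite ltnNge; apply/negP => nr.
  have := sum_part nu (leqnn _); rewrite (eq_bigr (fun i : 'I_n.+1 => nth 0 mu i)) => [|j _].
    by rewrite sum_part // => /n_Sn.
  by rewrite (eqP (e j)) /add_box ltn_eqF ?addn0 // (leq_trans (ltn_ord j)).
have [ni|ni] := ltnP i n.+1; first exact/eqP/(e (Ordinal ni)).
by rewrite /add_box !part_nth0 ?gtn_eqF ?(leq_trans rn) // ltnW.
Qed.

Lemma cover_at_lt nu mu r : cover_at nu mu r -> r < n.+1.
Proof.
move=> /cover_atP e; rewrite ltnNge; apply/negP => nr.
by have := e r; rewrite part_nth0 // /add_box eqxx addn1.
Qed.

Lemma cover_at_uniq nu mu r r' : cover_at nu mu r -> cover_at nu mu r' -> r = r'.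
Proof.
move=> /cover_atP e /cover_atP /(_ r); rewrite e /add_box eqxx.
by move/addnI; case: eqP.
Qed.

Lemma cover_at_removable nu mu r : cover_at nu mu r -> removable (nth 0 nu) r.
Proof.
move=> /cover_atP e; rewrite /removable !e /add_box eqxx gtn_eqF //.
by rewrite addn0 addn1 ltnS part_sorted.
Qed.

Lemma cover_at_addable nu mu r : cover_at nu mu r -> addable (nth 0 mu) r.
Proof.
move=> /cover_atP e; rewrite /addable; case: r => //= r in e *.
have := part_sorted nu (leqnSn r); rewrite !e /add_box eqxx.
by rewrite ltn_eqF // addn0 addn1.
Qed.

Lemma removable_cover nu r : removable (nth 0 nu) r ->
  exists2 mu : part n, cover_at nu mu r &
    forall i, nth 0 mu i = rem_box (nth 0 nu) r i.
Proof.
move=> rr; have rn : r < n.+1.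
  rewrite ltnNge; apply/negP => nr; move: rr; rewrite /removable.
  by rewrite [X in _ < X]part_nth0.
have [||| mu e] := @part_make n.+1 n (rem_box (nth 0 nu) r).
- move=> i; rewrite /rem_box; have := part_sorted nu (leqnSn i).
  by move: rr; rewrite /removable; case: (eqVneq i r) => [->|]; lia.
- by move=> i ni; rewrite /rem_box part_nth0.
- exact/sum_rem_box/sum_part.
exists mu => //; apply/cover_atP => i; rewrite /add_box e /rem_box.
by move: rr; rewrite /removable; case: eqP => [->|]; lia.
Qed.

Lemma addable_cover mu r : addable (nth 0 mu) r ->
  exists2 nu : part n.+1, cover_at nu mu r &
    forall i, nth 0 nu i = add_box (nth 0 mu) r i.
Proof.
move=> ar; have rn : r < n.+1.
  rewrite ltnNge; apply/negP => nr; move: ar; rewrite /addable.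
  by rewrite [X in _ < X]part_nth0; [case: r nr | case: r nr].
have [||| nu e] := @part_make n.+1 n.+1 (add_box (nth 0 mu) r).
- move=> i; rewrite /add_box; have := part_sorted mu (leqnSn i).
  by move: ar; rewrite /addable; case: (eqVneq i.+1 r) => [<-|] /=; lia.
- by move=> i ni; rewrite /add_box part_nth0 ?gtn_eqF ?(leq_trans rn) // ltnW.
- rewrite big_split /= sum_part // (bigD1 (Ordinal rn)) //= eqxx big1 ?addn0 ?addn1 //.
  by move=> i; rewrite -(inj_eq val_inj) => /= /negPf->.
by exists nu => //; apply/cover_atP => i; rewrite e.
Qed.

Lemma cover_at_injl nu nu' mu r : cover_at nu mu r -> cover_at nu' mu r -> nu = nu'.
Proof. by move=> /cover_atP e /cover_atP e'; apply: part_ext => i _; rewrite e e'. Qed.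

Lemma cover_at_injr nu mu mu' r : cover_at nu mu r -> cover_at nu mu' r -> mu = mu'.
Proof.
move=> /cover_atP e /cover_atP e'; apply: part_ext => i _.
by have := e i; rewrite e' /add_box => /addIn.
Qed.

Lemma sum_cover_at K nu mu : n < K -> \sum_(r < K) cover_at nu mu r = covers nu mu.
Proof.
move=> nK; rewrite /covers; case: existsP => [[r c]|nc]; last first.
  rewrite big1 // => r _; case c: (cover_at _ _ _) => //; case: nc.
  by exists (Ordinal (cover_at_lt c)).
rewrite (bigD1 (Ordinal (leq_trans (ltn_ord r) nK))) //= c big1 // => i ir.
case c': (cover_at _ _ _) => //; move: ir; rewrite -(inj_eq val_inj) /=.
by rewrite (cover_at_uniq c c') eqxx.
Qed.

Lemma box_paths_covers K nu : n < K -> box_paths K n.+1 (nth 0 nu) =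
  \sum_(mu : part n) covers nu mu * box_paths K n (nth 0 mu).
Proof.
move=> nK; under [RHS]eq_bigr do rewrite -(sum_cover_at _ _ nK) big_distrl /=.
rewrite exchange_big box_pathsS; apply: eq_bigr => r _ /=.
case rr: (removable _ _).
  have [mu c e] := removable_cover rr.
  rewrite mul1n (bigD1 mu) //= c mul1n big1 => [|mu' ne].
    by rewrite addn0; apply: eq_box_paths => i; rewrite e.
  by case c': (cover_at _ _ _) => //; rewrite (cover_at_injr c c') eqxx in ne.
rewrite big1 // => mu _; case c: (cover_at _ _ _) => //.
by rewrite (cover_at_removable c) in rr.
Qed.

Lemma sum_covers_box_paths K mu : n < K ->
  \sum_(nu : part n.+1) covers nu mu * box_paths K n.+1 (nth 0 nu) =
  n.+1 * box_paths K n (nth 0 mu).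
Proof.
move=> nK; rewrite -sum_add_box_paths; last 4 first.
- exact: leq_trans nK.
- by move=> i; apply: part_sorted.
- by rewrite part_nth0 //; case: K nK.
- by rewrite sum_part // ltnW.
under eq_bigr do rewrite -(sum_cover_at _ _ nK) big_distrl /=.
rewrite exchange_big; apply: eq_bigr => r _ /=.
case rr: (addable _ _).
  have [nu c e] := addable_cover rr.
  rewrite mul1n (bigD1 nu) //= c mul1n big1 => [|nu' ne].
    by rewrite addn0; apply: eq_box_paths => i; rewrite e.
  by case c': (cover_at _ _ _) => //; rewrite (cover_at_injl c c') eqxx in ne.
rewrite big1 // => nu _; case c: (cover_at _ _ _) => //.
by rewrite (cover_at_addable c) in rr.
Qed.

End Cover.

Lemma part0_eq (nu mu : part 0) : nu = mu.
Proof. exact: part_ext. Qed.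

Lemma part0_inhabited : inhabited (part 0).
Proof. by have [//|//||nu _] := @part_make 0 0 (fun=> 0); first by rewrite big_ord0. Qed.

(** One of the two factors is expanded by removing a box. After exchanging the sums, the sum over
    the larger shapes is given by the commutation relation and contributes n + 1. *)
Lemma sum_box_paths_sqr K n : n <= K ->
  \sum_(nu : part n) box_paths K n (nth 0 nu) ^ 2 = n`!.
Proof.
elim: n => [|n IH] nK.
  have [nu] := part0_inhabited.
  by rewrite (bigD1 nu) //= big1 => [|mu]; rewrite ?(part0_eq mu nu) ?eqxx // box_paths0.
transitivity (\sum_(nu : part n.+1) \sum_(mu : part n)
    box_paths K n (nth 0 mu) * (covers nu mu * box_paths K n.+1 (nth 0 nu))).
  apply: eq_bigr => nu _; rewrite expnS expn1 {1}box_paths_covers // big_distrl /=.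
  by apply: eq_bigr => mu _; rewrite mulnCA mulnA.
rewrite exchange_big factS -(IH (ltnW nK)) big_distrr; apply: eq_bigr => mu _ /=.
by rewrite -big_distrr sum_covers_box_paths // mulnCA.
Qed.

(** * Cells of a Young diagram *)

Section Cells.
Variables (n : nat) (nu : part n).

Definition row_of (x : nat) := reshape_index nu x.
Definition col_of (x : nat) := reshape_offset nu x.

Lemma sumn_part : sumn nu = n. Proof. by case: nu => s /= /and3P[_ _ /eqP]. Qed.

Lemma col_of_lt x : x < n -> col_of x < nth 0 nu (row_of x).
Proof. by move=> xn; apply: reshape_offsetP; rewrite sumn_part. Qed.

Lemma row_of_ltn x : x < n -> row_of x < n.
Proof.
move=> /col_of_lt h; rewrite ltnNge; apply/negP => nr.
by rewrite part_nth0 in h.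
Qed.

Lemma col_of_ltn x : x < n -> col_of x < n.
Proof. by move=> /col_of_lt h; apply: leq_trans h (part_le _ _). Qed.

Lemma cell_inj x y : row_of x = row_of y -> col_of x = col_of y -> x = y.
Proof.
rewrite /row_of /col_of => er ec.
by rewrite -(reshape_indexK nu x) -(reshape_indexK nu y) er ec.
Qed.

Lemma flatten_index_lt r c : c < nth 0 nu r -> flatten_index nu r c < n.
Proof. by move=> /flatten_indexP; rewrite sumn_part. Qed.

Lemma cell_exists r c : c < nth 0 nu r ->
  exists x : 'I_n, row_of x = r /\ col_of x = c.
Proof.
move=> cr; have xn := flatten_index_lt cr.
by exists (Ordinal xn); rewrite /row_of /col_of flatten_indexKl // flatten_indexKr.
Qed.

Lemma sum_cells (F : nat -> nat -> nat) :
  \sum_(x < n) F (row_of x) (col_of x) =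
  \sum_(r < n) \sum_(c < n) (c < nth 0 nu r) * F r c.
Proof.
rewrite pair_big /=.
under [RHS]eq_bigr do rewrite mulnbl.
rewrite -[RHS]big_mkcond /=.
rewrite (reindex_onto
  (fun x : 'I_n => (Ordinal (row_of_ltn (ltn_ord x)), Ordinal (col_of_ltn (ltn_ord x))))
  (fun rc : 'I_n * 'I_n => insubd rc.1 (flatten_index nu rc.1 rc.2))) /=.
  apply: eq_bigl => x; rewrite col_of_lt //=; apply/esym/eqP/val_inj.
  by rewrite val_insubd reshape_indexK ltn_ord.
case=> r c /= cr; have xn := flatten_index_lt cr.
congr pair; apply: val_inj; rewrite /= val_insubd xn.
  by rewrite /row_of flatten_indexKl.
by rewrite /col_of flatten_indexKr.
Qed.

End Cells.

Lemma sum_lt_ord n m : m <= n -> \sum_(c < n) (c < m) = m.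
Proof.
elim: n m => [|n IH] m; first by rewrite big_ord0 leqn0 => /eqP.
rewrite leq_eqVlt big_ord_recr /= => /predU1P[->|].
  rewrite ltnSn addn1 -[in RHS](IH n) //; congr _.+1.
  by apply: eq_bigr => i _; rewrite ltn_ord ltnW ?ltnS.
by rewrite ltnS => mn; rewrite IH // ltnNge mn addn0.
Qed.

(** * Dominance order and fillings without a common row and column *)

Definition dominated n (nu mu : part n) : Prop :=
  forall i, \sum_(r < n | r < i) nth 0 nu r <= \sum_(r < n | r < i) nth 0 mu r.

Lemma dominated_anti n (nu mu : part n) :
  dominated nu mu -> dominated mu nu -> nu = mu.
Proof.
move=> nm mn; apply: part_ext => i ni.
have e j : \sum_(r < n | r < j) nth 0 nu r = \sum_(r < n | r < j) nth 0 mu r.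
  by apply/eqP; rewrite eqn_leq nm mn.
have s (la : part n) : \sum_(r < n | r < i.+1) nth 0 la r =
    nth 0 la i + \sum_(r < n | r < i) nth 0 la r.
  rewrite (bigD1 (Ordinal ni)) //=; congr (_ + _); apply: eq_bigl => r.
  by rewrite -(inj_eq val_inj) /= ltnS [in RHS]ltn_neqAle andbC.
by have := e i.+1; rewrite !s e => /addIn.
Qed.

Section Dominance.
Variables (n : nat) (nu mu : part n) (g : 'S_n).
Hypothesis no_pair : forall x y : 'I_n, x != y ->
  row_of nu x = row_of nu y -> col_of mu (g x) <> col_of mu (g y).

(* N i j is at most i, as a row contributes at most one cell, and at most the
   length of column j of mu; M i j is the minimum of the two. *)
Let N (i j : nat) := \sum_(x < n) ((row_of nu x < i) && (col_of mu (g x) == j) : nat).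
Let M (i j : nat) := \sum_(x < n) ((row_of mu x < i) && (col_of mu x == j) : nat).

Let M_E i j : j < n -> M i j = \sum_(r < n) (r < i) * (j < nth 0 mu r).
Proof.
move=> jn; rewrite /M (sum_cells mu (fun r c => (r < i) && (c == j))).
apply: eq_bigr => r _; rewrite (bigD1 (Ordinal jn)) //= eqxx andbT big1 ?addn0.
  by rewrite mulnC.
by move=> c; rewrite -(inj_eq val_inj) /= => /negPf->; rewrite andbF muln0.
Qed.

Let N_row r j : \sum_(x < n) ((row_of nu x == r) && (col_of mu (g x) == j) : nat) <= 1.
Proof.
case: (pickP (fun x : 'I_n => (row_of nu x == r) && (col_of mu (g x) == j))) => [x px|none].
  rewrite (bigD1 x) //= px big1 // => y yx; case py: ((row_of nu y == r) && _) => //.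
  move: px py => /andP[/eqP xr /eqP xj] /andP[/eqP yr /eqP yj].
  by case: (no_pair yx); rewrite ?yr ?yj ?xr ?xj.
by rewrite big1 // => x _; rewrite none.
Qed.

Let N_split i j : N i j =
  \sum_(r < n) (r < i) * \sum_(x < n) ((row_of nu x == r) && (col_of mu (g x) == j) : nat).
Proof.
under [RHS]eq_bigr do rewrite big_distrr /=.
rewrite exchange_big; apply: eq_bigr => x _ /=.
rewrite (bigD1 (Ordinal (row_of_ltn nu (ltn_ord x)))) //= eqxx /= big1 ?addn0 ?mulnb //.
by move=> r; rewrite -(inj_eq val_inj) eq_sym /= => /negPf->; rewrite muln0.
Qed.

Let N_le_M i j : j < n -> N i j <= M i j.
Proof.
move=> jn; have N1 : N i j <= \sum_(r < n) (r < i).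
  rewrite N_split; apply: leq_sum => r _; rewrite -[X in _ <= X]muln1.
  by rewrite leq_mul2l N_row orbT.
have N2 : N i j <= \sum_(r < n) (j < nth 0 mu r).
  have <- : M n j = \sum_(r < n) (j < nth 0 mu r).
    by rewrite M_E //; apply: eq_bigr => r _; rewrite ltn_ord mul1n.
  rewrite /M (reindex_inj (@perm_inj _ g)); apply: leq_sum => x _ /=.
  by rewrite row_of_ltn //= ; case: (row_of nu x < i).
(* If some row r0 < i has length at most j, column j of [mu] ends before row i and its length is the
   minimum; otherwise each of the first i rows meets column j and the row count is the minimum. *)
rewrite M_E //; case: (pickP (fun r : 'I_n => (r < i) && (nth 0 mu r <= j))) => [r0|none].
  move=> /andP[r0i r0j]; apply: leq_trans N2 _; apply: leq_sum => r _.
  have [jr|//] := ltnP j (nth 0 mu r); rewrite (leq_ltn_trans _ r0i) //.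
  rewrite leqNgt; apply/negP => /ltnW /(part_sorted mu); lia.
apply: leq_trans N1 _; apply: leq_sum => r _; case: (ltnP r i) => // ri.
by have := none r; rewrite ri /= leqNgt => /negbFE ->.
Qed.

Let sum_rows (la : part n) i : \sum_(r < n | r < i) nth 0 la r =
  \sum_(x < n) (row_of la x < i : nat).
Proof.
rewrite (sum_cells la (fun r _ => (r < i : nat))) big_mkcond /=.
apply: eq_bigr => r _; rewrite -big_distrl /= sum_lt_ord ?part_le //.
by case: ifP; rewrite ?muln1 ?muln0.
Qed.

Let sum_col i (f : 'I_n -> nat) (h : 'I_n -> 'I_n) :
  \sum_(j < n) \sum_(x < n) ((f x < i) && (col_of mu (h x) == j) : nat) =
  \sum_(x < n) (f x < i : nat).
Proof.
rewrite exchange_big; apply: eq_bigr => x _ /=.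
rewrite (bigD1 (Ordinal (col_of_ltn mu (ltn_ord (h x))))) //= eqxx andbT big1 ?addn0 //.
by move=> j; rewrite -(inj_eq val_inj) eq_sym /= => /negPf->; rewrite andbF.
Qed.

(** Both partial sums are split by columns, and N is at most M in each column. *)
Lemma no_pair_dominated : dominated nu mu.
Proof.
move=> i; rewrite !sum_rows -(sum_col i _ g) -(sum_col i _ id).
by apply: leq_sum => j _; apply: N_le_M.
Qed.

Hypothesis same : nu = mu.

(** When the shapes agree, the column sums of N and M have equal totals, so N = M throughout.
    Comparing i with i + 1 shows that row i holds an entry sent to column j only if the cell (i, j)
    belongs to the shape. This provides the cells needed to factor g into a row and a column
    permutation. *)
Lemma no_pair_cell x : col_of mu (g x) < nth 0 mu (row_of nu x).
Proof.
have NM i j : j < n -> N i j = M i j.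
  move=> jn; have : \sum_(j < n) N i j == \sum_(j < n) M i j.
    rewrite (sum_col i (fun x => row_of nu x) g) (sum_col i (fun x => row_of mu x) id).
    by rewrite same.
  have /leqif_sum -> : forall j : 'I_n, true -> N i j <= M i j ?= iff (N i j == M i j).
    by move=> k _; split=> //; apply: N_le_M.
  by move=> /forallP /(_ (Ordinal jn)) /eqP.
have jn := col_of_ltn mu (ltn_ord (g x)); have rn := row_of_ltn nu (ltn_ord x).
have S (f : nat -> nat) : \sum_(r < n) (r < (row_of nu x).+1) * f r =
    f (row_of nu x) + \sum_(r < n) (r < row_of nu x) * f r.
  rewrite (bigD1 (Ordinal rn)) //= ltnSn mul1n; congr (_ + _).
  rewrite [RHS](bigD1 (Ordinal rn)) //= ltnn mul0n add0n; apply: eq_bigr => r.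
  by rewrite -(inj_eq val_inj) /= ltnS => ne; rewrite [in RHS]ltn_neqAle ne.
have := NM (row_of nu x).+1 _ jn; rewrite N_split M_E // (S (fun r => \sum_(x0 < n) ((row_of nu x0 == r) && (col_of mu (g x0) == col_of mu (g x)) : nat))).
rewrite -N_split NM // (S (fun r => (col_of mu (g x) < nth 0 mu r : nat))) -M_E // => /addIn.
rewrite (bigD1 x) //= !eqxx /=; by case: (_ < _).
Qed.

End Dominance.

(** * Skew standard tableaux *)

Section Fillings.
Variable K : nat.
Local Notation cell := ('I_K * 'I_K)%type.
Local Notation N := #|{: cell}|.
Implicit Types (D : {set cell}) (c e : cell) (t : {ffun cell -> 'I_N.+1}).

Definition cell_lt c e : bool :=
  ((c.1 == e.1) && (c.2 < e.2)) || ((c.2 == e.2) && (c.1 < e.1)).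

(* Fillings of D are extended by the top value outside of D, so that all of
   them have the same type. *)
Definition filling D t : bool :=
  [&& [forall c, if c \in D then t c < #|D| else t c == ord_max],
      [forall c in D, forall e in D, (t c == t e) ==> (c == e)]
    & [forall c in D, forall e in D, cell_lt c e ==> (t c < t e)]].

Lemma fillingP D t : reflect
  [/\ forall c, c \in D -> t c < #|D|, forall c, c \notin D -> t c = ord_max,
      {in D &, injective t} & {in D &, forall c e, cell_lt c e -> t c < t e}]
  (filling D t).
Proof.
apply: (iffP and3P) => [[/forallP h1 /forall_inP h2 /forall_inP h3]|[h1 h1' h2 h3]].
  split=> [c cD|c cD|c e cD eD tce|c e cD eD].
  - by have := h1 c; rewrite cD.
  - by have := h1 c; rewrite (negPf cD) => /eqP.
  - by apply/eqP; have /forall_inP/(_ _ eD)/implyP := h2 _ cD; apply; apply/eqP.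
  - by have /forall_inP/(_ _ eD)/implyP := h3 _ cD.
split.
- by apply/forallP => c; case: ifP => [/h1 //|/negbT/h1' ->].
- apply/forall_inP => c cD; apply/forall_inP => e eD; apply/implyP => /eqP tce.
  by apply/eqP/h2.
- by apply/forall_inP => c cD; apply/forall_inP => e eD; apply/implyP/h3.
Qed.

Definition nb_fillings D := #|[set t | filling D t]|.

Definition maximal_cell D c := (c \in D) && [forall e in D, ~~ cell_lt c e].

Lemma nb_fillings0 : nb_fillings set0 = 1.
Proof.
rewrite /nb_fillings -(cards1 [ffun=> ord_max] : #|[set [ffun=> ord_max : 'I_N.+1] : {ffun cell -> _}]| = 1).
apply: eq_card => t; rewrite !inE; apply/fillingP/eqP => [[_ h _ _]|->].
  by apply/ffunP => c; rewrite ffunE h ?inE.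
by split=> [c|c _|c e|c e]; rewrite ?inE // ffunE.
Qed.

Section Remove.
Variables (D : {set cell}) (k : nat).
Hypothesis Dk : #|D| = k.+1.

Let kN : k < N.+1.
Proof. by rewrite ltnS ltnW // -Dk max_card. Qed.

(** Pigeonhole: k + 1 distinct values below k + 1 include k exactly once. Written as a sum, it sorts
    fillings by the cell of their largest entry. *)
Lemma filling_top t : filling D t -> \sum_(c in D) (t c == k :> nat) = 1.
Proof.
move=> /fillingP [h1 _ h2 _].
have [c /andP[cD /eqP ck]] : exists c, (c \in D) && (t c == k :> nat).
  apply/existsP; apply: contraT; rewrite negb_exists => /forallP none.
  have : #|t @: D| <= #|[set i : 'I_N.+1 | i < k]|.
    apply/subset_leq_card/subsetP => _ /imsetP[c cD ->]; rewrite inE.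
    have := h1 c cD; have := none c; rewrite cD /= Dk ltnS.
    by move=> tk; rewrite leq_eqVlt (negPf tk).
  rewrite (card_in_imset h2) Dk.
  have -> : #|[set i : 'I_N.+1 | i < k]| = k.
    rewrite -[RHS](sum_lt_ord (ltnW kN)) -sum1_card big_mkcond /=.
    by apply: eq_bigr => i _; rewrite inE; case: ltnP.
  by rewrite ltnn.
rewrite (bigD1 c) //= ck eqxx big1 // => e /andP[eD ec]; case: eqP => // ek.
by case/eqP: ec; apply: h2 => //; apply: val_inj; rewrite /= ek ck.
Qed.

Lemma nb_fillings_top c : c \in D ->
  \sum_(t | filling D t) (t c == k :> nat) = maximal_cell D c * nb_fillings (D :\ c).
Proof.
move=> cD; have Dc : #|D :\ c| = k by apply/eqP; rewrite -eqSS -Dk (cardsD1 c D) cD.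
have ordk : nat_of_ord (inord k : 'I_N.+1) = k by rewrite inordK.
rewrite /maximal_cell cD /=; case: (boolP [forall e in D, _]) => [/forall_inP mx|]; last first.
  rewrite negb_forall_in => /exists_inP [e eD]; rewrite negbK => ce.
  rewrite big1 // => t /fillingP [h1 _ _ h3]; case: eqP => // ck.
  by have := h3 _ _ cD eD ce; have := h1 _ eD; rewrite ck Dk ltnS leqNgt => /negbTE ->.
rewrite mul1n /nb_fillings.
transitivity #|[set t | filling D t && (t c == k :> nat)]|.
  by rewrite -sum1_card -big_mkcondr /=; apply: eq_bigl => t; rewrite inE.
(* Erasing the largest entry gives c the value reserved for cells outside the shape; the inverse
   writes k back into c. *)
pose phi t : {ffun cell -> 'I_N.+1} := [ffun x => if x == c then ord_max else t x].
rewrite -(card_in_imset (f := phi)) => [|t u]; last first.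
  rewrite !inE => /andP[_ /eqP tk] /andP[_ /eqP uk] /ffunP e; apply/ffunP => x.
  have := e x; rewrite !ffunE; case: eqP => // -> _.
  by apply: val_inj; rewrite /= tk uk.
apply: eq_card => u; rewrite inE; apply/imsetP/fillingP => [[t] | [h1 h1' h2 h3]].
  rewrite inE => /andP[/fillingP [h1 h1' h2 h3] /eqP tk] ->; split.
  - move=> x xD; rewrite ffunE; move: xD; rewrite !inE => /andP[/negPf xc xD]; rewrite xc.
    have := h1 x xD; rewrite Dc Dk ltnS leq_eqVlt => /predU1P[xk|//].
    by case/eqP: xc; apply: h2 => //; apply: val_inj; rewrite /= tk xk.
  - move=> x; rewrite !inE ffunE negb_and negbK; case: eqP => //= _; exact: h1'.
  - move=> x y; rewrite !inE !ffunE => /andP[/negPf -> xD] /andP[/negPf -> yD]; exact: h2.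
  - move=> x y; rewrite !inE !ffunE => /andP[/negPf -> xD] /andP[/negPf -> yD]; exact: h3.
have u_lt x : x \in D -> x != c -> u x < k.
  by move=> xD xc; rewrite -Dc; apply: h1; rewrite !inE xc.
exists [ffun x => if x == c then inord k else u x]; last first.
  apply/ffunP => x; rewrite !ffunE; case: (eqVneq x c) => [->|//].
  by apply: h1'; rewrite !inE eqxx.
rewrite inE ffunE eqxx ordk eqxx andbT; apply/fillingP; split.
- move=> x xD; rewrite ffunE; case: (eqVneq x c) => [_|xc]; first by rewrite ordk Dk.
  by rewrite Dk ltnW // ltnS u_lt.
- move=> x xD; rewrite ffunE; case: (eqVneq x c) => [xc|xc]; first by rewrite xc cD in xD.
  by apply: h1'; rewrite !inE (negPf xD) andbF.
- move=> x y xD yD; rewrite !ffunE; case: (eqVneq x c) => [->|xc]; case: (eqVneq y c) => [->|yc] //.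
  + by move/(congr1 val); rewrite /= ordk => e; have := u_lt y yD yc; rewrite -e ltnn.
  + by move/(congr1 val); rewrite /= ordk => e; have := u_lt x xD xc; rewrite e ltnn.
  by apply: h2; rewrite !inE ?xc ?yc.
move=> x y xD yD xy; rewrite !ffunE; case: (eqVneq x c) => [xc|xc].
  by have := mx y yD; rewrite -xc xy.
case: (eqVneq y c) => [yc|yc]; first by rewrite ordk u_lt.
by apply: h3; rewrite ?inE ?xc ?yc.
Qed.

Lemma nb_fillings_rec :
  nb_fillings D = \sum_c maximal_cell D c * nb_fillings (D :\ c).
Proof.
transitivity (\sum_(t | filling D t) \sum_(c in D) (t c == k :> nat)).
  rewrite (eq_bigr (fun=> 1)) => [|t]; last exact: filling_top.
  by rewrite sum1_card; apply: eq_card => t; rewrite inE.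
rewrite exchange_big /= [RHS](bigID (mem D)) /= [X in _ = _ + X]big1 ?addn0.
  by apply: eq_bigr => c; apply: nb_fillings_top.
by move=> c /negPf cD; rewrite /maximal_cell cD.
Qed.

End Remove.
End Fillings.

Section SkewShape.
Variables (n m : nat) (al : part n) (ga : part m).

Definition skew_set K : {set 'I_K * 'I_K} :=
  [set c : 'I_K * 'I_K | nth 0 ga c.1 <= c.2 < nth 0 al c.1].

Lemma part_inclP : reflect (forall i, nth 0 ga i <= nth 0 al i) (part_incl ga al).
Proof.
apply: (iffP allP) => [h i|h i _]; last exact: h.
have [i_lt|i_ge] := ltnP i (size ga); last by rewrite nth_default.
by apply: h; rewrite mem_iota.
Qed.

Lemma card_skew_set K : n <= K -> m <= K -> part_incl ga al -> #|skew_set K| = n - m.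
Proof.
move=> nK mK /part_inclP gal.
rewrite -sum1_card big_mkcond /=.
transitivity (\sum_(r < K) \sum_(c < K) if (r, c) \in skew_set K then 1 else 0).
  by rewrite pair_bigA; apply: eq_bigr => -[].
rewrite -[in RHS](sum_part al nK) -[in RHS](sum_part ga mK).
rewrite -sumnB => [|r _]; last exact: gal.
apply: eq_bigr => r _.
rewrite -[in RHS](@sum_lt_ord K (nth 0 al r)); last exact: leq_trans (part_le _ _) nK.
rewrite -[in RHS](@sum_lt_ord K (nth 0 ga r)); last exact: leq_trans (part_le _ _) mK.
rewrite -sumnB => [|c _]; last first.
  by case: (ltnP c (nth 0 ga r)) => // cg; rewrite (leq_trans cg (gal r)).
apply: eq_bigr => c _; rewrite inE /=.
have := gal r; case: (ltnP c (nth 0 ga r)); case: (ltnP c (nth 0 al r)) => //= h1 h2.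
Qed.

Section Embed.
Variable K : nat.
Hypotheses (nK : n <= K) (mn : m <= n).

Let emb_cell (e : skew_cell al ga) : 'I_K * 'I_K :=
  (widen_ord nK (sval e).1, widen_ord nK (sval e).2).

Let emb_cell_inj : injective emb_cell.
Proof.
move=> [[r c] h] [[r' c'] h'] /= [er ec]; apply: val_inj => /=.
by congr pair; apply: val_inj.
Qed.

Let emb_cellP c : reflect (exists e, emb_cell e = c) (c \in skew_set K).
Proof.
apply: (iffP idP) => [|[[[r c'] h] <-]]; last by rewrite inE.
case: c => r c; rewrite inE /= => /andP[h1 h2].
have cn : c < n by apply: leq_trans h2 (part_le _ _).
have rn : r < n by rewrite ltnNge; apply/negP => /part_nth0 z; rewrite z in h2.
have h : in_skew al ga (Ordinal rn, Ordinal cn) by rewrite /in_skew /= h1 h2.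
exists (Sub (Ordinal rn, Ordinal cn) h); by congr pair; apply: val_inj.
Qed.

Let card_cells : #|skew_cell al ga| = #|skew_set K|.
Proof.
rewrite -(card_imset _ emb_cell_inj); apply: eq_card => c.
by apply/imsetP/emb_cellP => [[e _ ->]|[e <-]]; exists e.
Qed.

Lemma card_skew_cell : part_incl ga al -> #|skew_cell al ga| = n - m.
Proof. by rewrite card_cells; apply: card_skew_set => //; apply: leq_trans mn nK. Qed.

Let cell_lt_emb e f : cell_lt (emb_cell e) (emb_cell f) =
  (((sval e).1 == (sval f).1) && ((sval e).2 < (sval f).2)) ||
  (((sval e).2 == (sval f).2) && ((sval e).1 < (sval f).1)).
Proof. by []. Qed.

(** Places the tableaux in one K x K box. The type [skew_cell al ga] changes with the shape, whereas
    the recursion has to compare fillings of D and of D minus a cell. *)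
Lemma nb_skew_syt_fillings : part_incl ga al ->
  nb_skew_syt al ga = nb_fillings (skew_set K).
Proof.
rewrite /nb_skew_syt => ->; set D := skew_set K; rewrite /nb_fillings.
have DN : #|D| <= #|{: 'I_K * 'I_K}| by rewrite max_card.
have ltN (i : 'I_#|skew_cell al ga|) : i < #|{: 'I_K * 'I_K}|.
  by apply: leq_trans (ltn_ord i) _; rewrite card_cells.
pose phi (T : {ffun skew_cell al ga -> 'I_#|skew_cell al ga|}) :
    {ffun 'I_K * 'I_K -> 'I_#|{: 'I_K * 'I_K}|.+1} :=
  [ffun c => if [pick e | emb_cell e == c] is Some e then inord (T e) else ord_max].
have phi_emb T e : phi T (emb_cell e) = T e :> nat.
  rewrite ffunE; case: pickP => [f /eqP /emb_cell_inj ->|/(_ e)]; last by rewrite eqxx.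
  by rewrite inordK // ltnS ltnW.
have phi_out T c : c \notin D -> phi T c = ord_max.
  move=> cD; rewrite ffunE; case: pickP => // e /eqP ec; case/negP: cD.
  by apply/emb_cellP; exists e.
have phi_inj : injective phi.
  move=> T U TU; apply/ffunP => e; apply: val_inj.
  by rewrite /= -!phi_emb TU.
rewrite -(card_imset _ phi_inj); apply: eq_card => t; rewrite inE.
apply/imsetP/fillingP => [[T]|[h1 h1' h2 h3]].
  rewrite inE => /and3P[/injectiveP Ti /forallP Tr /forallP Tc] ->; split.
  - by move=> c /emb_cellP[e <-]; rewrite phi_emb -card_cells.
  - exact: phi_out.
  - move=> c f /emb_cellP[e <-] /emb_cellP[e' <-] /(congr1 val) /=.
    by rewrite !phi_emb => /val_inj /Ti ->.
  - move=> c f /emb_cellP[e <-] /emb_cellP[e' <-]; rewrite cell_lt_emb !phi_emb.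
    case/orP => h; first by have /forallP/(_ e')/implyP := Tr e; apply.
    by have /forallP/(_ e')/implyP := Tc e; apply.
have tD e : t (emb_cell e) < #|skew_cell al ga|.
  by rewrite card_cells; apply: h1; apply/emb_cellP; exists e.
have eD e : emb_cell e \in D by apply/emb_cellP; exists e.
exists [ffun e => Ordinal (tD e)]; last first.
  apply/ffunP => c; case: (boolP (c \in D)) => [/emb_cellP[e <-]|cD].
    by apply: val_inj; rewrite /= phi_emb ffunE.
  by rewrite phi_out // h1'.
rewrite inE; apply/and3P; split.
- apply/injectiveP => e f; rewrite !ffunE => /(congr1 val) /= /val_inj.
  by move/(h2 _ _ (eD e) (eD f)) => /emb_cell_inj.
- apply/forallP => e; apply/forallP => f; apply/implyP => h; rewrite !ffunE /=.
  by apply: h3; rewrite ?eD // cell_lt_emb h.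
apply/forallP => e; apply/forallP => f; apply/implyP => h; rewrite !ffunE /=.
by apply: h3; rewrite ?eD // cell_lt_emb h orbT.
Qed.

End Embed.

Lemma nb_skew_syt_le : m <= n -> nb_skew_syt al ga <= (n - m)`!.
Proof.
move=> mn; rewrite /nb_skew_syt; case: ifP => // incl.
have e := card_skew_cell (leqnn n) mn incl.
have c := card_inj_ffuns (skew_cell al ga) 'I_#|skew_cell al ga|.
rewrite -[(n - m)`!]ffactnn -e; move: c; rewrite card_ord => <-.
by apply/subset_leq_card/subsetP => T; rewrite !inE => /andP[].
Qed.

End SkewShape.

Lemma nb_skew_syt_id n (al ga : part n) : nb_skew_syt al ga = (al == ga).
Proof.
have [->|ne] := eqVneq al ga.
  have incl : part_incl ga ga by apply/part_inclP.
  rewrite (nb_skew_syt_fillings (leqnn n) incl).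
  have /eqP := card_skew_set (leqnn n) (leqnn n) incl.
  by rewrite subnn cards_eq0 => /eqP ->; rewrite nb_fillings0.
rewrite /nb_skew_syt; case: part_inclP => // incl; case/eqP: ne.
have : \sum_(i < n) nth 0 ga i == \sum_(i < n) nth 0 al i by rewrite !sum_part.
have /leqif_sum -> : forall i : 'I_n, true -> nth 0 ga i <= nth 0 al i
    ?= iff (nth 0 ga i == nth 0 al i) by move=> i _; split.
move=> /forallP e; apply: part_ext => i ni.
by have /eqP := e (Ordinal ni).
Qed.

(** The largest entry sits at a removable corner of [al] outside [ga]; erasing it leaves a tableau
    of shape [mu]/[ga]. As m <= n, the skew shape has a cell. *)
Lemma nb_skew_syt_rec m n (al : part n.+1) (ga : part m) : m <= n ->
  nb_skew_syt al ga = \sum_(mu : part n) covers al mu * nb_skew_syt mu ga.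
Proof.
move=> mn; pose K := n.+1.
have nK : n <= K by []. have mK : m <= K by apply: leq_trans mn nK.
case: (boolP (part_incl ga al)) => incl; last first.
  rewrite /nb_skew_syt (negPf incl) big1 // => mu _.
  case: (boolP (covers al mu)) => // /existsP [r /cover_atP e]; case: ifP => // /part_inclP i.
  case/part_inclP: incl => j; rewrite e; apply: leq_trans (i j) _; exact: leq_addr.
have inclP := part_inclP _ _ incl.
rewrite (nb_skew_syt_fillings (leqnn K) incl).
have Dk : #|skew_set al ga K| = (n - m).+1 by rewrite card_skew_set // subSn.
rewrite (nb_fillings_rec Dk).
(* R matches maximal cells c of the skew shape with the shapes [mu] obtained by deleting c that
   still contain [ga]. It is shown below to be functional in both directions. *)
pose R (c : 'I_K * 'I_K) (mu : part n) :=
  [&& cover_at al mu c.1, c.2 == nth 0 mu c.1 :> nat & part_incl ga mu].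
have R_max c mu : R c mu -> maximal_cell (skew_set al ga K) c /\
    skew_set al ga K :\ c = skew_set mu ga K.
  move=> /and3P[/[dup] cov /cover_atP e /eqP c2 /part_inclP i]; split.
    apply/andP; split; first by rewrite inE c2 i e /add_box eqxx addn1 ltnSn.
    apply/forall_inP => d; rewrite inE => /andP[_ d2]; rewrite /cell_lt.
    rewrite negb_or !negb_and; apply/andP; split.
      case: eqP => //= d1; rewrite -leqNgt c2 -ltnS.
      by move: d2; rewrite e -d1 /add_box eqxx addn1.
    case: eqP => //= c2d; rewrite -leqNgt leqNgt; apply/negP => cd.
    move: d2; rewrite -c2d c2 e /add_box gtn_eqF // addn0 ltnNge.
    by rewrite part_sorted // ltnW.
  apply/setP => d; rewrite !inE e /add_box.
  case: (eqVneq d.1 c.1) => [dc|dc]; last first.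
    rewrite (_ : d != c) /=; last by apply: contra_neq dc => ->.
    by rewrite (_ : (d.1 == c.1 :> nat) = false) ?addn0 //; apply/negbTE.
  rewrite dc eqxx addn1 ltnS; case: (eqVneq d c) => [->|dnc] /=.
    by rewrite c2 ltnn andbF.
  congr (_ && _); rewrite [in RHS]ltn_neqAle -c2.
  case: (eqVneq (d.2 : nat) c.2) => [d2|//]; case/eqP: dnc.
  by case: d c dc d2 {cov e c2} => [d1 d2] [c1 c2] /= -> /val_inj ->.
have max_R c : maximal_cell (skew_set al ga K) c -> exists mu, R c mu.
  case: c => r j /andP[]; rewrite inE /= => /andP[gj ja] /forall_inP mx.
  have ej : nth 0 al r = j.+1.
    apply/eqP; rewrite eqn_leq ja andbT leqNgt; apply/negP => j1.
    have jK : j.+1 < K by apply: leq_trans j1 (part_le _ _).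
    have := mx (r, Ordinal jK); rewrite inE /= j1 leqW // => /(_ isT).
    by rewrite /cell_lt /= eqxx ltnSn.
  have rr : removable (nth 0 al) r.
    rewrite /removable ej ltnS leqNgt; apply/negP => j1.
    have rK : r.+1 < K by rewrite ltnNge; apply/negP => /part_nth0 z; rewrite z in j1.
    have := mx (Ordinal rK, j); rewrite inE /= j1 andbT.
    rewrite (leq_trans (part_sorted ga (leqnSn r)) gj) => /(_ isT).
    by rewrite /cell_lt /= eqxx ltnSn orbT.
  have [mu cov e] := removable_cover rr; exists mu.
  rewrite /R cov /= e /rem_box eqxx ej subn1 eqxx /=; apply/part_inclP => i.
  rewrite e /rem_box; case: (eqVneq i r) => [->|_]; last by rewrite subn0.
  by rewrite ej subn1.
have R_uniq c mu mu' : R c mu -> R c mu' -> mu = mu'.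
  by move=> /and3P[h _ _] /and3P[h' _ _]; apply: cover_at_injr h h'.
transitivity (\sum_c \sum_(mu : part n) R c mu * nb_fillings (skew_set mu ga K)).
  apply: eq_bigr => c _; case: (boolP (maximal_cell _ c)) => mx.
    have [mu Rmu] := max_R c mx; have [_ ->] := R_max _ _ Rmu.
    rewrite mul1n (bigD1 mu) //= Rmu mul1n big1 ?addn0 // => mu' ne.
    by case: (boolP (R c mu')) => // /(R_uniq _ _ _ Rmu) e; rewrite e eqxx in ne.
  rewrite big1 // => mu _; case: (boolP (R c mu)) => // /R_max [h _].
  by rewrite h in mx.
rewrite exchange_big; apply: eq_bigr => mu _ /=; rewrite -big_distrl /=.
case: (boolP (part_incl ga mu)) => imu; last first.
  rewrite /nb_skew_syt (negPf imu) muln0 big1 // => c _.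
  by rewrite /R (negPf imu) !andbF.
rewrite (nb_skew_syt_fillings nK imu); congr (_ * _).
case: (boolP (covers al mu)) => [/existsP [r cov]|ncov].
  have muK : nth 0 mu r < K by rewrite ltnS part_le.
  rewrite (bigD1 (r, Ordinal muK)) //= /R /= cov eqxx imu big1 // => -[r' j] ne.
  case: (boolP (_ && _)) => // /and3P[/= cov' /eqP ej _]; case/eqP: ne.
  have er : r' = r by apply: val_inj; apply: cover_at_uniq cov' cov.
  by congr pair => //; apply: val_inj; rewrite /= ej er.
rewrite big1 // => c _; case: (boolP (R c mu)) => // /and3P[cov _ _].
by case/existsP: ncov; exists c.1.
Qed.

Local Open Scope ring_scope.
Local Open Scope sesquilinear_scope.

(** * The group algebra of the symmetric group *)

Section GroupAlgebraRing.
Variables (C : numClosedFieldType) (n : nat).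
Local Notation A := (galg C n).
Implicit Types (a b c : A) (s t g : 'S_n).

HB.instance Definition _ := GRing.Lmodule.copy A {ffun 'S_n -> C^o}.

Lemma galgD a b g : (a + b) g = a g + b g. Proof. exact: ffunE. Qed.
Lemma galg0 g : (0 : A) g = 0. Proof. exact: ffunE. Qed.
Lemma galgZ k a g : (k *: a) g = k * a g. Proof. exact: ffunE. Qed.
Lemma galg_sum I (r : seq I) P (F : I -> A) g :
  (\sum_(i <- r | P i) F i) g = \sum_(i <- r | P i) F i g.
Proof. exact: sum_ffunE. Qed.

Lemma gmulA : associative (@gmul C n).
Proof.
move=> a b c; apply/ffunP => g; rewrite !ffunE.
under eq_bigr do rewrite ffunE big_distrr /=.
under [RHS]eq_bigr do rewrite ffunE big_distrl /=.
rewrite [RHS]exchange_big; apply: eq_bigr => h _.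
rewrite (reindex_inj (mulgI h^-1%g)); apply: eq_bigr => k _ /=.
by rewrite invMg invgK mulrA !mulgA mulgK.
Qed.

Lemma gmul1l : left_id (gdelta C 1%g) (@gmul C n).
Proof.
move=> a; apply/ffunP => g; rewrite ffunE (bigD1 1%g) //= ffunE eqxx mul1r.
by rewrite big1 ?addr0 ?invg1 ?mul1g // => h /negPf e; rewrite ffunE e mul0r.
Qed.

Lemma gmul1r : right_id (gdelta C 1%g) (@gmul C n).
Proof.
move=> a; apply/ffunP => g; rewrite ffunE (bigD1 g) //= ffunE mulVg eqxx mulr1.
rewrite big1 ?addr0 // => h /negPf e; rewrite ffunE.
by rewrite eq_sym -(inj_eq (mulgI h)) mulKVg mulg1 e mulr0.
Qed.

Lemma gmulDl : left_distributive (@gmul C n) +%R.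
Proof.
move=> a b c; apply/ffunP => g; rewrite !ffunE -big_split.
by apply: eq_bigr => h _; rewrite ffunE mulrDl.
Qed.

Lemma gmulDr : right_distributive (@gmul C n) +%R.
Proof.
move=> a b c; apply/ffunP => g; rewrite !ffunE -big_split.
by apply: eq_bigr => h _; rewrite ffunE mulrDr.
Qed.

Lemma gdelta1_neq0 : gdelta C (1%g : 'S_n) != 0 :> A.
Proof. by apply/eqP => /ffunP /(_ 1%g) /eqP; rewrite !ffunE eqxx oner_eq0. Qed.

HB.instance Definition _ := GRing.Zmodule_isNzRing.Build A
  gmulA gmul1l gmul1r gmulDl gmulDr gdelta1_neq0.

Lemma galgM a b g : (a * b) g = \sum_h a h * b (h^-1 * g)%g.
Proof. exact: ffunE. Qed.

Lemma galg_scaleAl k a b : k *: (a * b) = (k *: a) * b.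
Proof.
apply/ffunP => g; rewrite galgZ !galgM big_distrr; apply: eq_bigr => h _ /=.
by rewrite galgZ mulrA.
Qed.

HB.instance Definition _ := GRing.Lmodule_isLalgebra.Build C A galg_scaleAl.

Lemma galg_scaleAr k a b : k *: (a * b) = a * (k *: b).
Proof.
apply/ffunP => g; rewrite galgZ !galgM big_distrr; apply: eq_bigr => h _ /=.
by rewrite galgZ mulrCA.
Qed.

HB.instance Definition _ := GRing.Lalgebra_isAlgebra.Build C A galg_scaleAr.

Local Notation d := (gdelta C).

Lemma mul_gdelta s a g : ((d s : A) * a) g = a (s^-1 * g)%g.
Proof.
rewrite galgM (bigD1 s) //= ffunE eqxx mul1r big1 ?addr0 // => h /negPf e.
by rewrite ffunE e mul0r.
Qed.

Lemma mulr_gdelta a s g : (a * (d s : A)) g = a (g * s^-1)%g.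
Proof.
rewrite galgM (bigD1 (g * s^-1)%g) //= ffunE invMg invgK mulgKV eqxx mulr1.
rewrite big1 ?addr0 // => h /negPf e; rewrite ffunE.
by rewrite -(inj_eq (mulgI h)) mulKVg -(inj_eq (mulIg s^-1%g)) mulgK eq_sym e mulr0.
Qed.

Lemma gdeltaM s t : (d s : A) * d t = d (s * t)%g.
Proof.
apply/ffunP => g; rewrite mul_gdelta !ffunE.
by rewrite -(inj_eq (mulgI s)) mulKVg.
Qed.

Lemma gdelta1 : d 1%g = 1 :> A. Proof. by []. Qed.

Lemma galg_delta a : a = \sum_s a s *: (d s : A).
Proof.
apply/ffunP => g; rewrite galg_sum (bigD1 g) //= galgZ ffunE eqxx mulr1.
rewrite big1 ?addr0 // => s; rewrite eq_sym => /negPf e.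
by rewrite galgZ ffunE e mulr0.
Qed.

Lemma gstarD a b : gstar (a + b) = gstar a + gstar b.
Proof. by apply/ffunP => g; rewrite !ffunE rmorphD. Qed.

Lemma gstarZ k a : gstar (k *: a) = k^* *: gstar a.
Proof. by apply/ffunP => g; rewrite galgZ !ffunE rmorphM. Qed.

Lemma gstar0 : gstar (0 : A) = 0.
Proof. by apply/ffunP => g; rewrite !ffunE rmorph0. Qed.

Lemma gstar_sum I (r : seq I) P (F : I -> A) :
  gstar (\sum_(i <- r | P i) F i) = \sum_(i <- r | P i) gstar (F i).
Proof. by rewrite (big_morph (@gstar C n) gstarD gstar0). Qed.

Lemma gstarM a b : gstar (a * b) = gstar b * gstar a.
Proof.
apply/ffunP => g; rewrite ffunE !galgM rmorph_sum /=.
rewrite [RHS](reindex_inj (mulgI g)) /=; apply: eq_bigr => h _.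
by rewrite !ffunE rmorphM mulrC !invMg !invgK mulKg.
Qed.

Lemma gstarK : involutive (@gstar C n).
Proof. by move=> a; apply/ffunP => g; rewrite !ffunE invgK conjCK. Qed.

Lemma gstar_delta s : gstar (d s : A) = d s^-1%g.
Proof.
by apply/ffunP => g; rewrite !ffunE rmorph_nat -(inj_eq invg_inj) invgK.
Qed.

(** The coefficient of [a * gstar a] at the identity is the sum of all |a h|^2. *)
Lemma mul_gstar_eq0 a : a * gstar a = 0 -> a = 0.
Proof.
move=> /ffunP /(_ 1%g); rewrite galgM [RHS]ffunE => /eqP; rewrite psumr_eq0.
  move=> /allP z; apply/ffunP => h; have /implyP := z h (mem_index_enum _).
  by rewrite mulg1 ffunE invgK mul_conjC_eq0 ffunE => /(_ isT) /eqP.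
by move=> h _; rewrite mulg1 ffunE invgK mul_conjC_ge0.
Qed.

(** ** Signed sums over a subgroup *)

(** The flag b chooses between the plain sum, for rows, and the alternating sum, for columns, so
    that both share their absorption lemmas. *)
Definition sgsum (b : bool) (H : {set 'S_n}) : A :=
  \sum_(s in H) (-1) ^+ (b && odd_perm s) *: d s.

Variable b : bool.
Local Notation eps s := ((-1) ^+ (b && odd_perm s) : C).

Lemma eps_mul s t : eps (s * t)%g = eps s * eps t.
Proof. by rewrite odd_permM; case: b; rewrite /= ?mulr1 // signr_addb. Qed.

Lemma sgsumM_l (H : {group 'S_n}) s :
  s \in H -> d s * sgsum b H = eps s *: sgsum b H.
Proof.
move=> sH; rewrite big_distrr scaler_sumr /= (reindex_inj (mulgI s^-1%g)) /=.
apply: eq_big => t; first by rewrite groupMl ?groupV.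
move=> _; rewrite -galg_scaleAr gdeltaM mulKVg eps_mul odd_permV scalerA.
by rewrite mulrC.
Qed.

Lemma sgsumM_r (H : {group 'S_n}) s :
  s \in H -> sgsum b H * d s = eps s *: sgsum b H.
Proof.
move=> sH; rewrite big_distrl scaler_sumr /= (reindex_inj (mulIg s^-1%g)) /=.
apply: eq_big => t; first by rewrite groupMr ?groupV.
move=> _; rewrite -galg_scaleAl gdeltaM mulgKV eps_mul odd_permV scalerA.
by rewrite mulrC.
Qed.

Lemma sgsum_mul (H K : {group 'S_n}) : K \subset H ->
  sgsum b K * sgsum b H = #|K|%:R *: sgsum b H.
Proof.
move=> KH; rewrite {1}/sgsum big_distrl /=.
transitivity (\sum_(s in K) sgsum b H); last by rewrite sumr_const scaler_nat.
apply: eq_bigr => s sK; rewrite -galg_scaleAl sgsumM_l ?(subsetP KH) // scalerA.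
by rewrite -signr_addb addbb scale1r.
Qed.

Lemma sgsum_star (H : {group 'S_n}) : gstar (sgsum b H) = sgsum b H.
Proof.
rewrite gstar_sum (reindex_inj invg_inj) /=; apply: eq_big => s; first by rewrite groupV.
by move=> _; rewrite gstarZ gstar_delta invgK odd_permV rmorph_sign.
Qed.

End GroupAlgebraRing.

(** * Young symmetrizers *)

Section Stabilizers.
Variables (n : nat) (nu : part n).

Lemma row_stabP (s : 'S_n) :
  reflect (forall x : 'I_n, row_of nu (s x) = row_of nu x) (s \in row_stab nu).
Proof. by rewrite inE; apply: (iffP forallP) => e x; apply/eqP/(e x). Qed.

Lemma col_stabP (s : 'S_n) :
  reflect (forall x : 'I_n, col_of nu (s x) = col_of nu x) (s \in col_stab nu).
Proof. by rewrite inE; apply: (iffP forallP) => e x; apply/eqP/(e x). Qed.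

Lemma row_stab_group : group_set (row_stab nu).
Proof.
apply/group_setP; split=> [|s t /row_stabP es /row_stabP et].
  by apply/row_stabP => x; rewrite perm1.
by apply/row_stabP => x; rewrite permM et es.
Qed.

Lemma col_stab_group : group_set (col_stab nu).
Proof.
apply/group_setP; split=> [|s t /col_stabP es /col_stabP et].
  by apply/col_stabP => x; rewrite perm1.
by apply/col_stabP => x; rewrite permM et es.
Qed.

Definition row_group := Group row_stab_group.
Definition col_group := Group col_stab_group.

Lemma row_col_stab1 s : s \in row_stab nu -> s \in col_stab nu -> s = 1%g.
Proof.
move=> /row_stabP er /col_stabP ec; apply/permP => x; rewrite perm1.
by apply/val_inj/(cell_inj (er x) (ec x)).
Qed.

Lemma tperm_row_stab (x y : 'I_n) : row_of nu x = row_of nu y -> tperm x y \in row_stab nu.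
Proof. by move=> e; apply/row_stabP => z; case: tpermP => // ->. Qed.

Lemma tperm_col_stab (x y : 'I_n) : col_of nu x = col_of nu y -> tperm x y \in col_stab nu.
Proof. by move=> e; apply/col_stabP => z; case: tpermP => // ->. Qed.

End Stabilizers.

Section YoungSymmetrizer.
Variables (C : numClosedFieldType) (n : nat).
Local Notation A := (galg C n).
Local Notation d := (gdelta C).
Implicit Types (x y : A) (nu mu : part n) (g s : 'S_n).

Lemma row_sumE nu : row_sum C nu = sgsum C false (row_group nu).
Proof.
apply/ffunP => g; rewrite ffunE galg_sum big_mkcond (bigD1 g) //= big1 ?addr0.
  by case: ifP; rewrite ?scale1r ?ffunE ?eqxx.
by move=> s sg; case: ifP => // _; rewrite scale1r ffunE eq_sym (negPf sg).
Qed.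

Lemma col_sumE nu : col_sum C nu = sgsum C true (col_group nu).
Proof.
apply/ffunP => g; rewrite ffunE galg_sum big_mkcond (bigD1 g) //= big1 ?addr0.
  by case: ifP => // _; rewrite galgZ ffunE eqxx mulr1.
by move=> s sg; case: ifP => // _; rewrite galgZ ffunE eq_sym (negPf sg) mulr0.
Qed.

Local Notation r nu := (row_sum C nu : A).
Local Notation c nu := (col_sum C nu : A).

Lemma row_sum_star nu : gstar (r nu) = r nu.
Proof. by rewrite row_sumE sgsum_star. Qed.

Lemma col_sum_star nu : gstar (c nu) = c nu.
Proof. by rewrite col_sumE sgsum_star. Qed.

Lemma row_sum_sqr nu : r nu * r nu = #|row_group nu|%:R *: r nu.
Proof. by rewrite row_sumE sgsum_mul. Qed.

Lemma col_sum_sqr nu : c nu * c nu = #|col_group nu|%:R *: c nu.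
Proof. by rewrite col_sumE sgsum_mul. Qed.

(** The row sum absorbs the transposition of x and y without a sign. Moved past g, it becomes the
    transposition of g x and g y, which the column sum absorbs with sign -1; the product equals its
    own negative. *)
Lemma row_delta_col_eq0 nu mu g (x y : 'I_n) : x != y -> row_of nu x = row_of nu y ->
  col_of mu (g x) = col_of mu (g y) -> r nu * d g * c mu = 0.
Proof.
move=> xy er ec; have tr := tperm_row_stab er; have tc := tperm_col_stab ec.
have e : r nu * d g * c mu = - (r nu * d g * c mu).
  rewrite -{1}[r nu]scale1r -[1](_ : (-1) ^+ (false && odd_perm (tperm x y)) = 1 :> C) //.
  rewrite {1}row_sumE -sgsumM_r // -row_sumE -mulrA -mulrA (mulrA (d _)) gdeltaM.
  have -> : (tperm x y * g = g * tperm (g x) (g y))%g by rewrite -tpermJ -conjgC.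
  rewrite -gdeltaM -mulrA {1}col_sumE sgsumM_l // -col_sumE odd_tperm /=.
  by rewrite (inj_eq perm_inj) xy scaleN1r !mulrN mulrA.
apply/eqP; move: (r nu * d g * c mu) e => z e.
have : 2%:R *: z == 0 by rewrite scaler_nat mulr2n {1}e addNr.
by rewrite scaler_eq0 pnatr_eq0.
Qed.

Lemma row_delta_col_dominated nu mu g :
  r nu * d g * c mu != 0 -> dominated nu mu.
Proof.
move=> nz; apply: (no_pair_dominated (g := g)) => u v uv er ec.
by rewrite (row_delta_col_eq0 uv er ec) eqxx in nz.
Qed.

Lemma mul_sum_deltas x y z : x * z * y = \sum_g z g *: (x * d g * y).
Proof.
rewrite {1}[z]galg_delta mulr_sumr mulr_suml; apply: eq_bigr => g _.
by rewrite -scalerAr -scalerAl.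
Qed.

Lemma row_mul_col_dominated nu mu x : r nu * x * c mu != 0 -> dominated nu mu.
Proof.
move=> nz; case: (pickP (fun g => r nu * d g * c mu != 0)) => [g|z].
  exact: row_delta_col_dominated.
move: nz; rewrite mul_sum_deltas big1 ?eqxx // => g _.
by have /negbFE/eqP -> := z g; rewrite scaler0.
Qed.

(** Row and column stabilizers meet only in the identity, so one term survives. Scalars in front of
    r c are read off from this coefficient. *)
Lemma young1 nu : (r nu * c nu) 1%g = 1.
Proof.
rewrite galgM (bigD1 1%g) //= big1 => [|s s1].
  rewrite !ffunE invg1 mulg1 odd_perm1 addr0.
  by rewrite (group1 (row_group nu)) (group1 (col_group nu)) mulr1.
rewrite !ffunE mulg1; case: (boolP (s \in row_stab nu)) => sr; rewrite ?mul0r //.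
case: ifP => // [sc|]; rewrite ?mulr0 //; have {}sc : s \in col_group nu by rewrite -groupV.
by rewrite (row_col_stab1 sr sc) eqxx in s1.
Qed.

(** It suffices to treat a single g. Either g sends two entries of one row to one column and the
    product vanishes, or g is a row permutation times a column permutation and the product is r c up
    to sign. *)
Lemma row_mul_col nu x : r nu * x * c nu = (r nu * x * c nu) 1%g *: (r nu * c nu).
Proof.
suff H g : r nu * d g * c nu = (r nu * d g * c nu) 1%g *: (r nu * c nu).
  rewrite {1 2}mul_sum_deltas galg_sum scaler_suml; apply: eq_bigr => g _.
  by rewrite galgZ -scalerA -H.
case: (pickP (fun xy : 'I_n * 'I_n => [&& xy.1 != xy.2,
    row_of nu xy.1 == row_of nu xy.2 & col_of nu (g xy.1) == col_of nu (g xy.2)])).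
  move=> [u v] /= /and3P[uv /eqP er /eqP ec].
  by rewrite (row_delta_col_eq0 uv er ec) galg0 scale0r.
move=> none.
have np : forall u v : 'I_n, u != v -> row_of nu u = row_of nu v ->
    col_of nu (g u) <> col_of nu (g v).
  by move=> u v uv er ec; have := none (u, v); rewrite /= uv er ec !eqxx.
(* f sends u to the cell in the row of u and the column of g u. Hence s = f permutes within rows,
   and s^-1 g within columns. *)
have /fin_all_exists [f fP] : forall u : 'I_n, exists v : 'I_n,
    row_of nu v = row_of nu u /\ col_of nu v = col_of nu (g u).
  by move=> u; apply/cell_exists/no_pair_cell.
have f_inj : injective f.
  move=> u v fuv; apply/eqP/negPn/negP => /np; case.
    by rewrite -(fP u).1 -(fP v).1 fuv.
  by rewrite -(fP u).2 -(fP v).2 fuv.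
pose s := perm f_inj; pose t := (s^-1 * g)%g.
have sR : s \in row_group nu by apply/row_stabP => u; rewrite permE; case: (fP u).
have tC : t \in col_group nu.
  apply/col_stabP => u; rewrite permM -{2}(permKV s u) [in RHS]permE.
  by case: (fP (s^-1%g u)).
have gE : g = (s * t)%g by rewrite /t mulKVg.
have e : r nu * d g * c nu = (-1) ^+ odd_perm t *: (r nu * c nu).
  rewrite gE -gdeltaM mulrA -mulrA {1}row_sumE sgsumM_r // scale1r -row_sumE.
  by rewrite col_sumE sgsumM_l // -scalerAr.
by rewrite {1}e e galgZ young1 mulr1.
Qed.

Definition young_scalar nu : C := (r nu * (c nu * r nu) * c nu) 1%g.

Lemma young_sqr nu :
  (r nu * c nu) * (r nu * c nu) = young_scalar nu *: (r nu * c nu).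
Proof. by rewrite -row_mul_col !mulrA. Qed.

Lemma young_neq0 nu : r nu * c nu != 0.
Proof.
by apply/eqP => /ffunP /(_ 1%g) /eqP; rewrite young1 galg0 oner_eq0.
Qed.

(** The product of r c and its adjoint is r c c r, a multiple of r c r. If r c r were zero, r c
    would be zero as well. *)
Lemma row_col_row_neq0 nu : r nu * c nu * r nu != 0.
Proof.
apply: contra_neq (young_neq0 nu) => z; apply: mul_gstar_eq0.
rewrite gstarM row_sum_star col_sum_star mulrA -(mulrA (r nu)) col_sum_sqr.
by rewrite -scalerAr -scalerAl z scaler0.
Qed.

(** The product of r c r with its adjoint is a multiple of (r c)^2 r, hence would vanish with the
    scalar. *)
Lemma young_scalar_neq0 nu : young_scalar nu != 0.
Proof.
apply: contra_neq (row_col_row_neq0 nu) => z; apply: mul_gstar_eq0.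
rewrite !gstarM row_sum_star col_sum_star.
transitivity (#|row_group nu|%:R *: (r nu * c nu * (r nu * c nu) * r nu)).
  rewrite -!mulrA (mulrA (r nu) (r nu)) row_sum_sqr.
  by rewrite -scalerAl -!scalerAr.
by rewrite young_sqr z scale0r mul0r scaler0.
Qed.

Definition young_idem nu : A := (young_scalar nu)^-1 *: (r nu * c nu).
Local Notation E := young_idem.

Lemma young_idemE nu x : E nu * x * E nu =
  (young_scalar nu)^-1 * (r nu * (c nu * x * r nu) * c nu) 1%g *: E nu.
Proof.
have Z : r nu * c nu * x * (r nu * c nu) =
    (r nu * (c nu * x * r nu) * c nu) 1%g *: (r nu * c nu).
  by rewrite -row_mul_col !mulrA.
rewrite /E -!scalerAl -scalerAr Z !scalerA.
by rewrite mulrAC -mulrA.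
Qed.

Lemma young_idemK nu : E nu * E nu = E nu.
Proof.
rewrite /E -scalerAl -scalerAr young_sqr !scalerA.
by rewrite -mulrA mulVf ?mulr1 // young_scalar_neq0.
Qed.

(** A nonzero product contains r_nu ... c_mu, and also the adjoint of some r_mu ... c_nu. Both are
    then nonzero, so each shape is dominated by the other. *)
Lemma young_idem_orth nu mu x : nu != mu -> E nu * x * E mu = 0.
Proof.
move=> nm; rewrite /E -!scalerAl -scalerAr.
suff -> : r nu * c nu * x * (r mu * c mu) = 0 by rewrite !scaler0.
apply: contraNeq nm => nz; apply/eqP/dominated_anti.
  apply: (@row_mul_col_dominated _ _ (c nu * x * r mu)).
  by move: nz; rewrite !mulrA.
apply: (@row_mul_col_dominated _ _ (gstar x)); move: nz; apply: contra_neq => z.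
have -> : r nu * c nu * x * (r mu * c mu) = r nu * (gstar (r mu * gstar x * c nu)) * c mu.
  by rewrite !gstarM gstarK row_sum_star col_sum_star !mulrA.
by rewrite z gstar0 mulr0 mul0r.
Qed.

(** ** The trace of the operator x |-> a x b on the group algebra *)

Definition gtr x y : C := \sum_g (x * d g * y) g.

Lemma gtr_linear_r x I (R : seq I) (k : I -> C) (F : I -> A) :
  gtr x (\sum_(i <- R) k i *: F i) = \sum_(i <- R) k i * gtr x (F i).
Proof.
rewrite /gtr; under eq_bigr do rewrite mulr_sumr galg_sum.
rewrite exchange_big; apply: eq_bigr => i _ /=.
by rewrite big_distrr; apply: eq_bigr => g _; rewrite -scalerAr galgZ.
Qed.

Lemma gtr_young nu mu : gtr (E nu) (E mu) = (nu == mu)%:R.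
Proof.
rewrite /gtr; have [<-|nm] := eqVneq nu mu; last first.
  by rewrite big1 // => g _; rewrite young_idem_orth // galg0.
(* k is the linear functional with E x E = k(x) E. The trace is k(E), which is 1 because E is a
   nonzero idempotent. *)
pose k x := (young_scalar nu)^-1 * (r nu * (c nu * x * r nu) * c nu) 1%g.
have k1 : \sum_g E nu g * k (d g) = k (E nu).
  rewrite /k {2}[E nu]galg_delta mulr_sumr mulr_suml mulr_sumr mulr_suml galg_sum.
  rewrite big_distrr; apply: eq_bigr => g _ /=.
  by rewrite -scalerAr -!scalerAl -scalerAr -scalerAl mulrCA [in RHS]galgZ.
transitivity (k (E nu)).
  by rewrite -k1; apply: eq_bigr => g _; rewrite young_idemE galgZ mulrC.
have kE : k (E nu) *: E nu = E nu by rewrite -young_idemE !young_idemK.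
have E0 : E nu != 0 by rewrite scaler_eq0 negb_or invr_eq0 young_scalar_neq0 young_neq0.
apply/eqP; rewrite -subr_eq0; have : (k (E nu) - 1) *: E nu == 0.
  by rewrite scalerBl kE scale1r subrr.
by rewrite scaler_eq0 (negPf E0) orbF.
Qed.

Lemma gtr_delta x s : gtr x (d s) = \sum_g x (g * s^-1 * g^-1)%g.
Proof. by apply: eq_bigr => g _; rewrite !mulr_gdelta. Qed.

Lemma gtr_delta_class x s t : gtr x (d (s ^ t)%g) = gtr x (d s).
Proof.
rewrite !gtr_delta (reindex_inj (mulIg t)); apply: eq_bigr => g _ /=.
by rewrite -conjVg conjgE !invMg !mulgA !mulgK.
Qed.

End YoungSymmetrizer.

(** * Pairing of characters along a homomorphism of symmetric groups *)

Section CharacterPairing.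
Variables (C : numClosedFieldType) (m n : nat) (iota : 'S_m -> 'S_n).
Hypothesis iotaM : forall s t, iota (s * t)%g = (iota s * iota t)%g.

Definition galg_map (b : galg C m) : galg C n :=
  \sum_s b s *: gdelta C (iota s).

Lemma iota1 : iota 1%g = 1%g.
Proof. by apply: (mulIg (iota 1%g)); rewrite -iotaM !mul1g. Qed.

Lemma iotaV s : iota s^-1%g = (iota s)^-1%g.
Proof. by apply: (mulIg (iota s)); rewrite -iotaM !mulVg iota1. Qed.

Lemma galg_map_delta s : galg_map (gdelta C s) = gdelta C (iota s).
Proof.
rewrite /galg_map (bigD1 s) //= ffunE eqxx scale1r big1 ?addr0 // => t /negPf ts.
by rewrite ffunE ts scale0r.
Qed.

Lemma galg_mapD a b : galg_map (a + b) = galg_map a + galg_map b.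
Proof. by rewrite -big_split; apply: eq_bigr => s _; rewrite galgD scalerDl. Qed.

Lemma galg_mapZ k a : galg_map (k *: a) = k *: galg_map a.
Proof. by rewrite scaler_sumr; apply: eq_bigr => s _; rewrite galgZ scalerA. Qed.

Lemma galg_map0 : galg_map 0 = 0.
Proof. by rewrite -(scale0r 0) galg_mapZ scale0r. Qed.

Lemma galg_map_sum I (r : seq I) P (F : I -> galg C m) :
  galg_map (\sum_(i <- r | P i) F i) = \sum_(i <- r | P i) galg_map (F i).
Proof. by rewrite (big_morph _ galg_mapD galg_map0). Qed.

Lemma galg_mapM a b : galg_map (a * b) = galg_map a * galg_map b.
Proof.
rewrite {1}[a]galg_delta {1}[b]galg_delta mulr_suml galg_map_sum mulr_suml.
apply: eq_bigr => s _; rewrite mulr_sumr galg_map_sum mulr_sumr.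
apply: eq_bigr => t _; rewrite -!scalerAl -!scalerAr !galg_mapZ.
by rewrite !gdeltaM galg_map_delta iotaM.
Qed.

(** [gtr b] at s^-1 is a sum of coefficients of b over conjugates of s. Substituting s moves the
    conjugation onto [gtr a], a class function, so all m! conjugating elements contribute equally.
    For [iota] the identity this yields character orthogonality, for an embedding the multiplicities
    of a restriction. *)
Lemma gtr_pairing (a : galg C n) (b : galg C m) :
  \sum_s gtr b (gdelta C s^-1%g) * gtr a (gdelta C (iota s)) =
  (m`!)%:R * gtr a (galg_map b).
Proof.
rewrite gtr_linear_r.
under eq_bigr do rewrite gtr_delta big_distrl /=.
rewrite exchange_big /=.
under eq_bigr => g _.
  rewrite (reindex_inj (conjg_inj g)) /=.
  under eq_bigr => s _.
    rewrite invgK conjgE !mulgA mulgV mul1g mulgK.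
    rewrite -[(g^-1 * s * g)%g]mulgA -conjgE.
    have -> : iota (s ^ g)%g = (iota s ^ iota g)%g by rewrite !conjgE !iotaM iotaV.
    rewrite gtr_delta_class.
    over.
  over.
by rewrite sumr_const card_Sn mulr_natl.
Qed.

End CharacterPairing.

(** * Characters of Specht modules *)

(** In the rank factorization of an idempotent, the two factors multiply in the opposite order to an
    identity matrix whose size is the rank. *)
Lemma mxtrace_idem (F : fieldType) m (P : 'M[F]_m) :
  P *m P = P -> \tr P = (\rank P)%:R.
Proof.
move=> PP; have e : row_base P *m col_base P = 1%:M.
  move: (row_base_free P) (col_base_full P) (mulmx_base P).
  move: (row_base P) (col_base P) => r c fr fc cr.
  apply: (row_free_inj fr); apply: (row_full_inj fc).
  by rewrite /= mul1mx -mulmxA mulmxA cr PP.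
by rewrite -{1}(mulmx_base P) mxtrace_mulC e mxtrace1.
Qed.

Section Grow.
Variables (C : numClosedFieldType) (n : nat).
Local Notation A := (galg C n).
Local Notation d := (gdelta C).
Local Notation N := #|[set: 'S_n]|.
Implicit Types (a b : A) (s g : 'S_n).

Lemma sum_enum_perm (V : nmodType) (F : 'S_n -> V) :
  \sum_(i < N) F (enum_val i) = \sum_s F s.
Proof. by rewrite -big_enum_val; apply: eq_bigl => s; rewrite inE. Qed.

Lemma grow_is_semilinear : semilinear (@grow C n).
Proof. by split=> [k a|a b]; apply/rowP => i; rewrite !mxE ?galgZ ?galgD. Qed.

HB.instance Definition _ :=
  GRing.isSemilinear.Build C A 'rV[C]_N _ (@grow C n) grow_is_semilinear.

Lemma grow_inj : injective (@grow C n).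
Proof.
move=> a b /rowP e; apply/ffunP => s; have := e (enum_rank_in (in_setT s) s).
by rewrite !mxE enum_rankK_in ?inE.
Qed.

Lemma grow_surj (v : 'rV[C]_N) : exists a, v = grow a.
Proof.
exists [ffun s => v 0 (enum_rank_in (in_setT 1%g) s)].
by apply/rowP => i; rewrite mxE ffunE enum_valK_in.
Qed.

Lemma grow_delta s : grow (d s : A) = delta_mx 0 (gring_index [set: 'S_n] s).
Proof.
apply/rowP => i; rewrite !mxE ffunE eqxx /=; congr (_%:R); congr nat_of_bool.
apply/eqP/eqP => [<-|->]; first by rewrite gring_valK.
by rewrite gring_indexK ?inE.
Qed.

Definition opmx (f : A -> A) : 'M[C]_N := \matrix_i grow (f (d (enum_val i))).

Lemma grow_opmx (f : {linear A -> A}) a : grow a *m opmx f = grow (f a).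
Proof.
rewrite {2}[a]galg_delta linear_sum linear_sum /= mulmx_sum_row.
rewrite -[RHS]sum_enum_perm; apply: eq_bigr => i _.
by rewrite rowK mxE !linearZ.
Qed.

Lemma tr_opmx (f : A -> A) : \tr (opmx f) = \sum_s f (d s) s.
Proof. by rewrite -sum_enum_perm; apply: eq_bigr => i _; rewrite !mxE. Qed.

Lemma grow_regular a s : grow a *m sym_regular C n s = grow (a * d s).
Proof.
rewrite [a]galg_delta mulr_suml !linear_sum mulmx_suml; apply: eq_bigr => g _ /=.
rewrite -scalerAl !linearZ /= -scalemxAl gdeltaM; congr (_ *: _).
by rewrite !grow_delta -rowE rowK gring_indexK ?inE.
Qed.

Lemma mx_grow_ext m (M P : 'M[C]_(N, m)) :
  (forall a, grow a *m M = grow a *m P) -> M = P.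
Proof. by move=> e; apply/row_matrixP => i; rewrite !rowE; have [a ->] := grow_surj (delta_mx 0 i). Qed.

Definition sandwich a b (x : A) := a * x * b.

Lemma sandwich_is_semilinear a b : semilinear (sandwich a b).
Proof.
split=> [k x|x y]; rewrite /sandwich; first by rewrite -scalerAr -scalerAl.
by rewrite mulrDr mulrDl.
Qed.

HB.instance Definition _ a b :=
  GRing.isSemilinear.Build C A A _ (sandwich a b) (sandwich_is_semilinear a b).

Lemma gtr_opmx a b : gtr a b = \tr (opmx (sandwich a b)).
Proof. by rewrite tr_opmx. Qed.

Lemma gtr_idem_nat a b : a * a = a -> b * b = b ->
  exists2 m : nat, gtr a b = m%:R & m = 0%N -> forall x, a * x * b = 0.
Proof.
move=> aa bb; exists (\rank (opmx (sandwich a b))).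
  rewrite gtr_opmx mxtrace_idem //; apply: mx_grow_ext => x.
  by rewrite mulmxA !grow_opmx /= /sandwich !mulrA aa -mulrA bb.
move=> /eqP; rewrite mxrank_eq0 => /eqP z x; apply: grow_inj.
by have := grow_opmx (sandwich a b) x; rewrite z mulmx0 linear0.
Qed.

End Grow.

Section SpechtCharacter.
Variables (C : numClosedFieldType) (n : nat).
Local Notation A := (galg C n).
Local Notation d := (gdelta C).
Local Notation E := (@young_idem C n).
Implicit Types (nu mu : part n) (s : 'S_n).

Definition chi nu s : C := \tr (specht C nu s).

(** P is the orthogonal projection onto the Specht ideal, and L, left multiplication by E, is
    another projection with the same image that commutes with the action. From L P = L and P L = P,
    cyclicity of the trace replaces P by L. *)
Lemma chiE nu s : chi nu s = gtr (E nu) (d s).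
Proof.
pose L := opmx (sandwich (E nu) 1); pose R s := sym_regular C n s.
have LR t : L *m R t = R t *m L.
  apply: mx_grow_ext => a; rewrite !mulmxA grow_opmx !grow_regular grow_opmx /=.
  by rewrite /sandwich !mulr1 mulrA.
have LL : L *m L = L.
  by apply: mx_grow_ext => a; rewrite mulmxA !grow_opmx /= /sandwich !mulr1 mulrA young_idemK.
have spL : (specht_sp C nu :=: L)%MS.
  apply/eqmxP/andP; split.
    apply: cyclic_mx_sub.
      by apply/mxmoduleP => t _; rewrite [X in (X <= _)%MS]LR submxMl.
    apply/submxP; exists (grow (young_symmetrizer C nu)); rewrite grow_opmx /=.
    congr grow; rewrite /sandwich mulr1 /young_idem -scalerAl young_sqr scalerA.
    by rewrite mulVf ?scale1r // young_scalar_neq0.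
  apply/row_subP => i; rewrite rowK /sandwich mulr1 /young_idem -scalerAl linearZ /=.
  apply: scalemx_sub; rewrite -grow_regular.
  apply: submx_trans (submxMr _ (cyclic_mx_id _ _)) _.
  by apply: (mxmoduleP (cyclic_mx_module _ _)); rewrite inE.
pose B := specht_basis C nu; pose P := B ^t* *m B.
have BL : (B :=: L)%MS := eqmx_trans (specht_basis_eq C nu) spL.
have /unitarymxP BB := specht_basis_unitary C nu.
have LP : L *m P = L.
  have /submxP[D ->] : (L <= B)%MS by rewrite BL.
  by rewrite /P mulmxA -(mulmxA D) BB mulmx1.
have PL : P *m L = P.
  have /submxP[D ->] : (P <= L)%MS by rewrite -BL submxMl.
  by rewrite -mulmxA LL.
transitivity (\tr (R s *m P)).
  by rewrite /chi /specht /specht_mx /= -mulmxA mxtrace_mulC mulmxA.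
rewrite -PL mulmxA mxtrace_mulC mulmxA LR -mulmxA LP.
have -> : R s *m L = opmx (sandwich (E nu) (d s)).
  apply: mx_grow_ext => a; rewrite mulmxA grow_regular !grow_opmx /=.
  by rewrite /sandwich mulr1 mulrA.
by rewrite -gtr_opmx.
Qed.

Lemma chi1 nu : chi nu 1%g = (specht_dim C nu)%:R.
Proof. by rewrite /chi repr_mx1 mxtrace1. Qed.

Lemma specht_inv nu s : specht C nu s^-1%g = (specht C nu s) ^t*.
Proof.
rewrite repr_mxV ?inE // invmx_unitary //; exact: specht_unitary.
Qed.

Lemma chiV nu s : chi nu s^-1%g = (chi nu s)^*.
Proof. by rewrite /chi specht_inv -map_trmx mxtrace_tr trace_map_mx. Qed.

Lemma chi_conj nu s t : chi nu (s ^ t)%g = chi nu s.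
Proof. by rewrite !chiE gtr_delta_class. Qed.

Lemma galg_map_id (b : A) : galg_map id b = b.
Proof. by rewrite /galg_map -galg_delta. Qed.

Lemma chi_orth nu mu :
  \sum_s chi nu s^-1%g * chi mu s = (n`!)%:R * (nu == mu)%:R.
Proof.
under eq_bigr do rewrite !chiE.
have := @gtr_pairing C n n id (fun _ _ => erefl) (E mu) (E nu).
by rewrite galg_map_id gtr_young eq_sym => <-.
Qed.

Lemma chi_gt0 nu : (0 < specht_dim C nu)%N.
Proof.
rewrite lt0n; apply/eqP => d0; have := chi_orth nu nu; rewrite big1 => [|s _].
  by rewrite eqxx mulr1 => /esym/eqP; rewrite pnatr_eq0 -leqn0 leqNgt fact_gt0.
by rewrite {1}/chi /mxtrace big1 ?mul0r // => i; have := ltn_ord i; rewrite {2}d0.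
Qed.

(** The regular character minus its Specht part. It is orthogonal to every [chi nu], and its square
    norm carries the factor n! - sum f^2 of Bessel's inequality. *)
Let D s : C := (n`!)%:R * (s == 1%g)%:R - \sum_(nu : part n) (specht_dim C nu)%:R * chi nu s.

Let sum_chi_D nu : \sum_s chi nu s^-1%g * D s = 0.
Proof.
rewrite /D; under eq_bigr do rewrite mulrBr big_distrr /=.
rewrite sumrB exchange_big /= (bigD1 (1 : 'S_n)%g) //= (bigD1 nu) //=.
under [X in _ - (X + _)]eq_bigr do rewrite mulrCA.
rewrite -big_distrr /= chi_orth invg1 chi1 !eqxx !mulr1 big1 => [|s /negPf ->].
  rewrite big1 ?addr0 => [|mu mn]; first by rewrite mulrC subrr.
  under eq_bigr do rewrite mulrCA.
  by rewrite -big_distrr /= chi_orth eq_sym (negPf mn) !mulr0.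
by rewrite !mulr0.
Qed.

Let norm_D : \sum_s (D s)^* * D s =
  (n`!)%:R * ((n`!)%:R - \sum_(nu : part n) (specht_dim C nu)%:R ^+ 2).
Proof.
under eq_bigr do rewrite {1}/D rmorphB mulrBl rmorph_sum big_distrl /=.
rewrite sumrB exchange_big /= [X in _ - X]big1 => [|nu _]; last first.
  transitivity ((specht_dim C nu)%:R * \sum_s chi nu s^-1%g * D s).
    rewrite big_distrr /=.
    by apply: eq_bigr => s _; rewrite rmorphM chiV rmorph_nat mulrA.
  by rewrite sum_chi_D mulr0.
rewrite subr0 (bigD1 1%g) //= big1 => [|s /negPf ->].
  rewrite rmorphM !rmorph_nat eqxx mulr1 addr0 /D eqxx mulr1; congr (_ * (_ - _)).
  by apply: eq_bigr => nu _; rewrite chi1.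
by rewrite mulr0 rmorph0 mul0r.
Qed.

Lemma sum_specht_dim_sqr_le : (\sum_(nu : part n) specht_dim C nu ^ 2 <= n`!)%N.
Proof.
rewrite -(ler_nat C) -subr_ge0 -(pmulr_rge0 _ (_ : 0 < (n`!)%:R)) ?ltr0n ?fact_gt0 //.
rewrite natr_sum; under eq_bigr do rewrite natrX.
by rewrite -norm_D; apply: sumr_ge0 => s _; rewrite mulrC mul_conjC_ge0.
Qed.

Lemma regular_char s : (\sum_(nu : part n) specht_dim C nu ^ 2 = n`!)%N ->
  \sum_(nu : part n) (specht_dim C nu)%:R * chi nu s = (n`!)%:R * (s == 1%g)%:R.
Proof.
move=> e; apply/esym/eqP; rewrite -subr_eq0 -/(D s).
have : \sum_s (D s)^* * D s == 0.
  rewrite norm_D; under eq_bigr do rewrite -natrX.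
  by rewrite -natr_sum e subrr mulr0.
rewrite psumr_eq0 => [|t _]; last by rewrite mulrC mul_conjC_ge0.
by move=> /allP /(_ s (mem_index_enum _)); rewrite /= mulrC mul_conjC_eq0.
Qed.

End SpechtCharacter.

(** * The branching rule *)

Section Embedding.
Variables (m n : nat) (mn : (m <= n)%N).

(** Points are separated by their value, with no cast to a sum of two sizes, so that successive
    embeddings compose as in [emb_emb]. *)
Definition emb_fun (s : 'S_m) (x : 'I_n) : 'I_n :=
  if insub (val x) is Some y then widen_ord mn (s y) else x.

Lemma emb_fun_inj s : injective (emb_fun s).
Proof.
move=> x y; rewrite /emb_fun; case: insubP => [u _ ux|mx]; case: insubP => [v _ vy|my] //.
- by move/(congr1 val) => /= /val_inj /perm_inj uv; apply: val_inj; rewrite -ux uv.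
- by move=> e; case/negP: my; rewrite -e /= ltn_ord.
- by move=> e; case/negP: mx; rewrite e /= ltn_ord.
Qed.

Definition emb (s : 'S_m) : 'S_n := perm (@emb_fun_inj s).

Lemma emb_widen s y : emb s (widen_ord mn y) = widen_ord mn (s y).
Proof. by rewrite permE /emb_fun /= valK. Qed.

Lemma emb_ge s (x : 'I_n) : (m <= x)%N -> emb s x = x.
Proof. by rewrite leqNgt permE /emb_fun => h; rewrite insubN. Qed.

Lemma widen_or_ge (x : 'I_n) : (exists y, x = widen_ord mn y) \/ (m <= x)%N.
Proof.
have [xm|mx] := ltnP x m; [left | by right].
by exists (Ordinal xm); apply: val_inj.
Qed.

Lemma embM s t : emb (s * t)%g = (emb s * emb t)%g.
Proof.
apply/permP => x; rewrite permM; have [[y ->]|mx] := widen_or_ge x.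
  by rewrite !emb_widen permM.
by rewrite !emb_ge // emb_ge.
Qed.

End Embedding.

Lemma emb_emb l m n (lm : (l <= m)%N) (mn : (m <= n)%N) (ln : (l <= n)%N) s :
  emb mn (emb lm s) = emb ln s.
Proof.
apply/permP => x; have [[y ->]|mx] := widen_or_ge mn x; last first.
  by rewrite !emb_ge // (leq_trans lm).
rewrite emb_widen; have [[z ->]|ly] := widen_or_ge lm y; last first.
  by rewrite !emb_ge.
have e : widen_ord mn (widen_ord lm z) = widen_ord ln z by apply: val_inj.
by rewrite emb_widen !e emb_widen; apply: val_inj.
Qed.

Lemma emb_id n (nn : (n <= n)%N) (s : 'S_n) : emb nn s = s.
Proof.
have w (y : 'I_n) : widen_ord nn y = y by apply: val_inj.
by apply/permP => x; rewrite -{1}(w x) emb_widen w.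
Qed.

Section Multiplicity.
Variables (C : numClosedFieldType) (m n : nat) (mn : (m <= n)%N).
Local Notation d := (gdelta C).
Implicit Types (al : part n) (ga : part m).

(** The multiplicity of S^ga in the restriction of S^al, as the trace of x |-> E_al x E_ga. *)
Definition mult_char al ga : C :=
  gtr (young_idem C al) (galg_map (emb mn) (young_idem C ga)).

Lemma mult_char_pairing al ga :
  \sum_s chi C ga s^-1%g * chi C al (emb mn s) = (m`!)%:R * mult_char al ga.
Proof.
under eq_bigr do rewrite !chiE.
by rewrite (gtr_pairing (@embM _ _ mn)).
Qed.

Lemma mult_char_nat al ga : exists2 k : nat, mult_char al ga = k%:R &
  k = 0%N -> forall x, young_idem C al * x * galg_map (emb mn) (young_idem C ga) = 0.
Proof.
apply: gtr_idem_nat; first exact: young_idemK.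
by rewrite -(galg_mapM (@embM _ _ mn)) young_idemK.
Qed.

End Multiplicity.

Section CoverMultiplicity.
Variables (C : numClosedFieldType) (n : nat) (nu : part n.+1) (mu : part n).
Variable r : nat.
Hypothesis nm : cover_at nu mu r.
Local Notation d := (gdelta C).
Local Notation iota := (emb (leqnSn n)).
Local Notation up := (galg_map iota).

Let nuE i : nth 0%N nu i = add_box (nth 0%N mu) r i.
Proof. exact/cover_atP. Qed.

(** Both shapes are filled in row-reading order, so an entry of [mu] need not occupy the same cell
    in [nu]. The permutation w corrects this, sending the last point to the added cell. *)
Lemma cover_perm : exists w : 'S_n.+1, forall y : 'I_n,
  row_of nu (w (widen_ord (leqnSn n) y)) = row_of mu y /\
  col_of nu (w (widen_ord (leqnSn n) y)) = col_of mu y.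
Proof.
pose P (x z : 'I_n.+1) := if (x < n)%N then
   row_of nu z = row_of mu x /\ col_of nu z = col_of mu x
  else row_of nu z = r /\ col_of nu z = nth 0%N mu r.
have /fin_all_exists [f fP] : forall x, exists z, P x z.
  move=> x; rewrite /P; case: ltnP => xn; apply: cell_exists.
    by rewrite nuE /add_box (leq_trans (col_of_lt mu xn)) ?leq_addr.
  by rewrite nuE /add_box eqxx addn1.
have f_inj : injective f.
  have aux (x y : 'I_n.+1) : (x < n)%N -> (y < n)%N = false -> f x <> f y.
    move=> xn yn fxy; have := fP x; have := fP y; rewrite /P xn yn fxy.
    by move=> [e1 e2] [e3 e4]; have := col_of_lt mu xn; rewrite -e3 -e4 e1 e2 ltnn.
  move=> x y; case xn : (x < n)%N; case yn : (y < n)%N => fxy.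
  - have := fP x; have := fP y; rewrite /P xn yn fxy => -[e1 e2] [e3 e4].
    by apply: val_inj; apply: (@cell_inj _ mu); rewrite -?e1 -?e2 -?e3 -?e4.
  - by case: (aux _ _ xn yn).
  - by case: (aux _ _ yn xn).
  apply: val_inj => /=; move: xn yn (ltn_ord x) (ltn_ord y); lia.
exists (perm f_inj) => y; rewrite permE; have := fP (widen_ord (leqnSn n) y).
by rewrite /P /= ltn_ord.
Qed.

Lemma odd_emb s : odd_perm (iota s) = odd_perm s.
Proof.
have -> : iota s = lift_perm ord_max ord_max s.
  have w y : widen_ord (leqnSn n) y = lift ord_max y by apply: val_inj; rewrite -[RHS]/(nat_of_ord _) lift_max.
  apply/permP => x; have [[y ->]|nx] := widen_or_ge (leqnSn n) x.
    by rewrite emb_widen !w lift_perm_lift.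
  have -> : x = ord_max by apply/val_inj/eqP; rewrite eqn_leq nx -ltnS ltn_ord.
  by rewrite emb_ge // lift_perm_id.
by rewrite odd_lift_perm addbb.
Qed.

(* Otherwise a product of row and column sums of mu and nu would show that
   r_nu c_nu r_nu = 0. *)
Lemma cover_young_neq0 : exists x,
  young_idem C nu * x * up (young_idem C mu) != 0.
Proof.
have [w wP] := cover_perm.
pose rn : galg C n.+1 := row_sum C nu; pose cn : galg C n.+1 := col_sum C nu.
pose rm : galg C n := row_sum C mu; pose cm : galg C n := col_sum C mu.
have iw s (x : 'I_n.+1) : (iota s ^ w)%g (w x) = w (iota s x) by rewrite permJ.
(* Conjugation by w carries the stabilizers of [mu] into those of [nu], whose sums therefore absorb
   the sums for [mu] up to the orders of the groups. *)
have row_in s : s \in row_group mu -> (iota s ^ w)%g \in row_group nu.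
  move=> /row_stabP sP; apply/row_stabP => z; rewrite -(permKV w z) iw.
  have [[y ->]|mx] := widen_or_ge (leqnSn n) (w^-1%g z); last by rewrite emb_ge.
  by rewrite emb_widen !(wP _).1 sP.
have col_in s : s \in col_group mu -> (iota s ^ w)%g \in col_group nu.
  move=> /col_stabP sP; apply/col_stabP => z; rewrite -(permKV w z) iw.
  have [[y ->]|mx] := widen_or_ge (leqnSn n) (w^-1%g z); last by rewrite emb_ge.
  by rewrite emb_widen !(wP _).2 sP.
have upE b (H : {group 'S_n}) : up (sgsum C b H) =
    \sum_(s in H) (-1) ^+ (b && odd_perm s) *: d (iota s).
  rewrite /sgsum galg_map_sum; apply: eq_bigr => s _.
  by rewrite galg_mapZ galg_map_delta.
have upl b (H : {group 'S_n}) (G : {group 'S_n.+1}) :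
    (forall s, s \in H -> (iota s ^ w)%g \in G) ->
    sgsum C b G * d w^-1%g * up (sgsum C b H) = #|H|%:R *: (sgsum C b G * d w^-1%g).
  move=> HG; rewrite upE mulr_sumr.
  transitivity (\sum_(s in H) sgsum C b G * d w^-1%g); last by rewrite sumr_const scaler_nat.
  apply: eq_bigr => s sH; rewrite -scalerAr -mulrA gdeltaM.
  have -> : (w^-1 * iota s = iota s ^ w * w^-1)%g by rewrite conjgE !mulgA mulgK.
  rewrite -gdeltaM mulrA (sgsumM_r C b (HG s sH)) odd_permJ odd_emb -scalerAl scalerA.
  by rewrite -signr_addb addbb scale1r.
have upr b (H : {group 'S_n}) (G : {group 'S_n.+1}) :
    (forall s, s \in H -> (iota s ^ w)%g \in G) ->
    up (sgsum C b H) * (d w * sgsum C b G) = #|H|%:R *: (d w * sgsum C b G).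
  move=> HG; rewrite upE mulr_suml.
  transitivity (\sum_(s in H) (d w * sgsum C b G)); last by rewrite sumr_const scaler_nat.
  apply: eq_bigr => s sH; rewrite -scalerAl mulrA gdeltaM conjgC.
  rewrite -gdeltaM -mulrA (sgsumM_l C b (HG s sH)) odd_permJ odd_emb -scalerAr scalerA.
  by rewrite -signr_addb addbb scale1r.
pose k := young_scalar C mu.
(* With this witness the product is a nonzero multiple of r_nu c_nu w^-1 c_mu r_mu c_mu. Multiplying
   on the right by r_mu w r_nu turns it into a nonzero multiple of r_nu c_nu r_nu. *)
exists (d w^-1%g * up cm); apply: contra_neq (row_col_row_neq0 C nu) => z.
have {}z : rn * cn * d w^-1%g * up cm * up rm * up cm = 0.
  move: z; rewrite /young_idem galg_mapZ (galg_mapM (@embM _ _ _)) -!scalerAl -!scalerAr.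
  move=> /eqP; rewrite !scaler_eq0 !invr_eq0 (negPf (young_scalar_neq0 C _)).
  by rewrite (negPf (young_scalar_neq0 C _)) /= !mulrA => /eqP.
have crcr : cm * rm * cm * rm = k^* *: (cm * rm).
  have := congr1 (@gstar C n) (young_sqr C mu).
  by rewrite gstarZ !gstarM row_sum_star col_sum_star !mulrA.
have : up (cm * rm * cm * rm) = k^* *: up (cm * rm) by rewrite crcr galg_mapZ.
rewrite !(galg_mapM (@embM _ _ _)) => {}crcr.
have e : rn * cn * d w^-1%g * up cm * up rm * up cm * up rm * (d w * rn) =
    (k^* * (#|col_group mu|%:R * #|row_group mu|%:R)) *: (rn * cn * rn).
  transitivity (k^* *: (rn * (cn * d w^-1%g * up cm) * (up rm * (d w * rn)))).
    transitivity (rn * cn * d w^-1%g * (up cm * up rm * up cm * up rm) * (d w * rn)).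
      by rewrite !mulrA.
    by rewrite crcr -scalerAr -scalerAl !mulrA.
  rewrite /cn /cm /rn /rm !col_sumE !row_sumE upl // upr // -!scalerAr -!scalerAl.
  rewrite !scalerA -mulrA [X in _ * X]mulrC; congr (_ *: _).
  by rewrite -!mulrA (mulrA (d _) (d _)) gdeltaM mulVg mul1r.
move/eqP: e; rewrite z !mul0r eq_sym scaler_eq0 !mulf_eq0 conjC_eq0.
by rewrite (negPf (young_scalar_neq0 C _)) !pnatr_eq0 !(gtn_eqF (cardG_gt0 _)) /= => /eqP.
Qed.

End CoverMultiplicity.

Section Branching.
Variable C : numClosedFieldType.

(** The sum of f(ga) chi_ga is the regular character of S_m, supported at the identity; pairing it
    with the restriction of chi_al evaluates the latter there. *)
Lemma chi_sum_mult m n (mn : (m <= n)%N) (al : part n) :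
  (\sum_(ga : part m) specht_dim C ga ^ 2 = m`!)%N ->
  \sum_(ga : part m) (specht_dim C ga)%:R * mult_char C mn al ga =
    (specht_dim C al)%:R.
Proof.
move=> e; have m0 : (m`!)%:R != 0 :> C by rewrite pnatr_eq0 -lt0n fact_gt0.
apply: (mulfI m0); rewrite big_distrr /=.
under eq_bigr do rewrite mulrCA -mult_char_pairing big_distrr /=.
rewrite exchange_big /= (bigD1 (1 : 'S_m)%g) //= [X in _ + X]big1 => [|s s1].
  rewrite addr0; under eq_bigr do rewrite mulrA.
  by rewrite -big_distrl /= regular_char // invg1 eqxx mulr1 (iota1 (@embM _ _ _)) chi1.
under eq_bigr do rewrite mulrA.
by rewrite -big_distrl /= regular_char // -(inj_eq invg_inj) invgK invg1 (negPf s1) mulr0 mul0r.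
Qed.

Theorem specht_dimE K n (nu : part n) : (n <= K)%N ->
  specht_dim C nu = box_paths K n (nth 0%N nu).
Proof.
elim: n nu => [|n IH] nu nK.
  rewrite box_paths0; have := sum_specht_dim_sqr_le C 0.
  rewrite (bigD1 nu) //= => /(leq_trans (leq_addr _ _)); have := chi_gt0 C nu.
  by case: specht_dim => [|[|k]].
have sq m : (forall mu : part m, specht_dim C mu = box_paths K m (nth 0%N mu)) ->
    (m <= K)%N -> (\sum_(mu : part m) specht_dim C mu ^ 2 = m`!)%N.
  move=> e mK; rewrite -(sum_box_paths_sqr mK); apply: eq_bigr => mu _.
  by rewrite e.
have IHn mu := IH mu (ltnW nK).
have ge (la : part n.+1) : (box_paths K n.+1 (nth 0%N la) <= specht_dim C la)%N.
  rewrite -(ler_nat C) -(chi_sum_mult (leqnSn n) la (sq n IHn (ltnW nK))).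
  rewrite box_paths_covers // natr_sum; apply: ler_sum => mu _.
  rewrite natrM mulrC -IHn ler_wpM2l ?ler0n //.
  have [k -> k0] := mult_char_nat C (leqnSn n) la mu.
  rewrite ler_nat; case cov: (covers la mu) => //.
  rewrite lt0n; apply/eqP => /k0 z; have /existsP [r c] := cov.
  by have [x] := cover_young_neq0 C c; rewrite z eqxx.
have := sum_specht_dim_sqr_le C n.+1; rewrite -(sum_box_paths_sqr nK) => le.
have : (\sum_(la : part n.+1) box_paths K n.+1 (nth 0%N la) ^ 2 ==
        \sum_(la : part n.+1) specht_dim C la ^ 2)%N.
  by rewrite eqn_leq le andbT; apply: leq_sum => la _; rewrite leq_exp2r.
have /leqif_sum -> : forall la : part n.+1, true ->
    (box_paths K n.+1 (nth 0%N la) ^ 2 <= specht_dim C la ^ 2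
      ?= iff (box_paths K n.+1 (nth 0%N la) ^ 2 == specht_dim C la ^ 2))%N.
  by move=> la _; split=> //; rewrite leq_exp2r.
by move=> /forallP /(_ nu) /=; rewrite eqn_exp2r // => /eqP.
Qed.

Lemma sum_specht_dim_sqr n : (\sum_(nu : part n) specht_dim C nu ^ 2 = n`!)%N.
Proof.
rewrite -(sum_box_paths_sqr (leqnn n)); apply: eq_bigr => nu _.
by rewrite (@specht_dimE n).
Qed.

Lemma sum_dim_chi n (s : 'S_n) :
  \sum_(nu : part n) (specht_dim C nu)%:R * chi C nu s = (n`!)%:R * (s == 1%g)%:R.
Proof. exact/regular_char/sum_specht_dim_sqr. Qed.

(** The dimension of S^nu is the sum of f(mu) over covered [mu] and also the sum of f(mu) times the
    multiplicities. Each multiplicity is at least the cover indicator and the weights are positive,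
    so all inequalities are equalities. *)
Lemma branching n (nu : part n.+1) (mu : part n) :
  mult_char C (leqnSn n) nu mu = (covers nu mu)%:R.
Proof.
have ge (la : part n) : (covers nu la)%:R <= mult_char C (leqnSn n) nu la.
  have [k -> k0] := mult_char_nat C (leqnSn n) nu la.
  rewrite ler_nat; case cov: (covers nu la) => //.
  rewrite lt0n; apply/eqP => /k0 z; have /existsP [r c] := cov.
  by have [x] := cover_young_neq0 C c; rewrite z eqxx.
have := chi_sum_mult (leqnSn n) nu (sum_specht_dim_sqr n).
rewrite (@specht_dimE n.+1 _ nu) // box_paths_covers // natr_sum => /esym/eqP.
under eq_bigr do rewrite natrM mulrC -(specht_dimE _ (leqnSn n)).
have /leif_sum -> : forall la : part n, true ->
   (specht_dim C la)%:R * (covers nu la)%:R <=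
   (specht_dim C la)%:R * mult_char C (leqnSn n) nu la
   ?= iff (mult_char C (leqnSn n) nu la == (covers nu la)%:R).
  move=> la _; split; first by rewrite ler_wpM2l ?ler0n.
  rewrite (inj_eq (mulfI _)); first by rewrite eq_sym.
  by rewrite pnatr_eq0 -lt0n chi_gt0.
by move=> /forallP /(_ mu) /eqP.
Qed.

End Branching.

(** * Intertwiners *)

Lemma tr_lin_mx (F : fieldType) a b (f : {linear 'M[F]_(a, b) -> 'M[F]_(a, b)}) :
  \tr (lin_mx f) = \sum_i \sum_j f (delta_mx i j) i j.
Proof.
rewrite pair_big /mxtrace /=.
rewrite (reindex (uncurry (@mxvec_index a b))) /=; last first.
  exact: curry_mxvec_bij.
by apply: eq_bigr => -[i j] _ /=; rewrite !mxE /= vec_mx_delta mxvecE.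
Qed.

(** Links the dimension of a [{vspace}] to the rank of a projection onto it, which can be computed
    as a trace. *)
Lemma dimv_rank_lin_mx (F : fieldType) a b (U : {vspace 'M[F]_(a, b)})
    (f : {linear 'M[F]_(a, b) -> 'M[F]_(a, b)}) :
  (forall x, f x \in U) -> (forall x, x \in U -> f x = x) ->
  \dim U = \rank (lin_mx f).
Proof.
move=> fU fid; pose B := \matrix_(i < \dim U) mxvec (vbasis U)`_i.
have bU i : (i < \dim U)%N -> (vbasis U)`_i \in U.
  by move=> iU; apply: vbasis_mem; rewrite mem_nth // size_tuple.
have B_free : row_free B.
  apply: inj_row_free => v vB; apply/rowP => i; rewrite mxE.
  have /freeP fr := basis_free (vbasisP U); apply: (fr (fun i => v 0 i)).
  apply: (can_inj mxvecK); rewrite linear0 -vB linear_sum mulmx_sum_row /=.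
  by apply: eq_bigr => k _; rewrite linearZ rowK.
suff /eqmxP e : (B == lin_mx f)%MS by rewrite -e (eqP B_free).
apply/andP; split; apply/row_subP => i.
  rewrite rowK; apply/submxP; exists (mxvec (vbasis U)`_i).
  by rewrite mul_vec_lin /= fid // bU.
rewrite rowE -[delta_mx 0 i]vec_mxK mul_vec_lin /=.
rewrite (coord_vbasis (fU (vec_mx (delta_mx 0 i)))) linear_sum /=.
apply: summx_sub => k _; rewrite linearZ scalemx_sub //.
by have := row_sub k B; rewrite rowK.
Qed.

Lemma mul_delta_entry (R : pzRingType) m n p q (M : 'M[R]_(m, n)) (P : 'M[R]_(p, q)) i j k l :
  (M *m delta_mx j k *m P) i l = M i j * P k l.
Proof.
rewrite mxE (bigD1 k) //= big1 ?addr0 => [|u uk].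
  rewrite mxE (bigD1 j) //= big1 ?addr0 => [|v vj]; first by rewrite mxE !eqxx mulr1.
  by rewrite mxE (negPf vj) mulr0.
rewrite mxE big1 ?mul0r // => v _; by rewrite mxE (negPf uk) andbF mulr0.
Qed.

Section Averaging.
Variables (C : numClosedFieldType) (m a b : nat).
Variables (rho : 'S_m -> 'M[C]_a) (sigma : 'S_m -> 'M[C]_b).
Hypothesis rho1 : rho 1%g = 1%:M.
Hypothesis rhoM : forall s t, rho (s * t)%g = rho s *m rho t.
Hypothesis sigmaM : forall s t, sigma (s * t)%g = sigma s *m sigma t.

Definition intertwines (phi : 'M[C]_(a, b)) := forall s, rho s *m phi = phi *m sigma s.

Definition average (phi : 'M[C]_(a, b)) : 'M[C]_(a, b) :=
  (m`!)%:R^-1 *: \sum_s rho s^-1%g *m phi *m sigma s.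

Lemma average_is_semilinear : semilinear average.
Proof.
split=> [k x|x y]; rewrite /average.
  rewrite scalerA [k * _]mulrC -scalerA [in RHS]scaler_sumr; congr (_ *: _).
  by apply: eq_bigr => s _; rewrite -scalemxAr -scalemxAl.
rewrite -scalerDr -big_split /=; congr (_ *: _).
by apply: eq_bigr => s _; rewrite mulmxDr mulmxDl.
Qed.

HB.instance Definition _ := GRing.isSemilinear.Build C 'M[C]_(a, b) 'M[C]_(a, b) _
  average average_is_semilinear.

Lemma fact_neq0 k : (k`!)%:R != 0 :> C.
Proof. by rewrite pnatr_eq0 -lt0n fact_gt0. Qed.

Lemma average_intertwines phi : intertwines (average phi).
Proof.
move=> t; rewrite /average -scalemxAr -scalemxAl mulmx_sumr mulmx_suml; congr (_ *: _).
rewrite (reindex_inj (mulIg t)) /=; apply: eq_bigr => s _.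
by rewrite sigmaM !mulmxA -rhoM invMg mulgA mulgV mul1g.
Qed.

Lemma average_id phi : intertwines phi -> average phi = phi.
Proof.
move=> iphi; rewrite /average; under eq_bigr do rewrite -mulmxA -iphi mulmxA -rhoM mulVg rho1 mul1mx.
by rewrite sumr_const card_Sn -scaler_nat scalerA mulVf ?scale1r ?fact_neq0.
Qed.

(** Averaging is a projection onto the intertwiners, so its rank is its trace; each summand phi |->
    rho(s^-1) phi sigma(s) contributes the product of two traces. *)
Lemma rank_average : (m`!)%:R * (\rank (lin_mx average))%:R =
  \sum_s \tr (rho s^-1%g) * \tr (sigma s).
Proof.
rewrite -mxtrace_idem; last first.
  apply/row_matrixP => i; rewrite !rowE mulmxA -[delta_mx 0 i]vec_mxK !mul_vec_lin /=.
  by rewrite average_id //; apply: average_intertwines.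
rewrite tr_lin_mx /=; under eq_bigr do under eq_bigr do rewrite mxE summxE.
under eq_bigr do rewrite -big_distrr /= exchange_big /=.
rewrite -big_distrr /= exchange_big /= mulrA divff ?fact_neq0 // mul1r.
apply: eq_bigr => s _; rewrite big_distrl /=; apply: eq_bigr => i _.
rewrite big_distrr; apply: eq_bigr => j _ /=.
by rewrite mul_delta_entry.
Qed.

End Averaging.

Section SpechtIntertwiners.
Variables (C : numClosedFieldType).
Local Notation rho al := (specht C al).

Let r1 n (al : part n) : rho al 1%g = 1%:M. Proof. exact: repr_mx1. Qed.
Let rM n (al : part n) (s t : 'S_n) : rho al (s * t)%g = rho al s *m rho al t.
Proof. by rewrite repr_mxM ?inE. Qed.

(** By character orthogonality the averaging projection has rank zero. *)
Lemma specht_schur n (al be : part n) phi : al != be ->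
  intertwines (rho al) (rho be) phi -> phi = 0.
Proof.
move=> ab iphi; rewrite -(average_id (r1 al) (rM al) iphi).
have := rank_average (r1 al) (rM al) (rM be).
rewrite -/(chi C al _) (chi_orth C al be) (negPf ab) mulr0 => /eqP.
rewrite mulf_eq0 (negPf (fact_neq0 _ _)) pnatr_eq0 mxrank_eq0 => /eqP z.
apply: (can_inj mxvecK); rewrite linear0.
have := mul_vec_lin (average (rho al) (rho be)) phi.
by rewrite z mulmx0 => <-.
Qed.

(** Here the averaging projection has rank one, and its image already contains the identity
    matrix. *)
Lemma specht_schur_scalar n (al : part n) phi :
  intertwines (rho al) (rho al) phi -> phi = (\tr phi / (specht_dim C al)%:R)%:M.
Proof.
move=> iphi; pose av := lin_mx (average (rho al) (rho al)).
have rk : \rank av = 1%N.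
  apply/eqP; rewrite -(eqr_nat C); apply/eqP/(mulfI (fact_neq0 C n)).
  apply: etrans (rank_average (r1 al) (rM al) (rM al)) _.
  by apply: etrans (chi_orth C al al) _; rewrite eqxx.
have in_av psi : intertwines (rho al) (rho al) psi -> (mxvec psi <= av)%MS.
  by move=> i; apply/submxP; exists (mxvec psi); rewrite mul_vec_lin /= (average_id (r1 al) (rM al) i).
have i1 : intertwines (rho al) (rho al) 1%:M by move=> s; rewrite mulmx1 mul1mx.
have d0 : (specht_dim C al)%:R != 0 :> C by rewrite pnatr_eq0 -lt0n chi_gt0.
have n0 : mxvec (1%:M : 'M[C]_(specht_dim C al)) != 0.
  rewrite -(inj_eq (can_inj vec_mxK)) mxvecK linear0; apply: contra_neq d0 => e.
  by rewrite -mxtrace1 e mxtrace0.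
have av1 : (av <= mxvec (1%:M : 'M[C]_(specht_dim C al)))%MS.
  by rewrite -(geq_leqif (mxrank_leqif_sup (in_av _ i1))) rk lt0n mxrank_eq0.
have /submxP [k e] := submx_trans (in_av _ iphi) av1.
have {e} -> : phi = (k 0 0)%:M.
  apply: (can_inj mxvecK); rewrite e [k]mx11_scalar mul_scalar_mx -linearZ /=.
  by rewrite scale_scalar_mx mulr1 mxE eqxx mulr1n.
by rewrite mxtrace_scalar -(mulr_natr (k 0 0)) mulfK.
Qed.

Lemma dim_intertwiners m n (mn : (m <= n)%N) (al : part n) (ga : part m)
    (U : {vspace 'M[C]_(specht_dim C ga, specht_dim C al)}) :
  (forall phi, phi \in U <-> intertwines (rho ga) (fun s => rho al (emb mn s)) phi) ->
  (\dim U)%:R = mult_char C mn al ga.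
Proof.
move=> UP; pose sg s := rho al (emb mn s).
have sM s t : sg (s * t)%g = sg s *m sg t by rewrite /sg embM rM.
apply: (mulfI (fact_neq0 C m)).
rewrite (dimv_rank_lin_mx (f := average (rho ga) sg)).
- by rewrite (rank_average (r1 ga) (rM ga) sM) -mult_char_pairing.
- by move=> x; apply/UP/(average_intertwines (rM ga) sM).
by move=> x /UP; apply: (average_id (r1 ga) (rM ga)).
Qed.

End SpechtIntertwiners.

(** * Action of the group algebra on Specht modules and Fourier inversion *)

Section GalgOp.
Variables (C : numClosedFieldType) (n : nat).
Local Notation A := (galg C n).
Local Notation d := (gdelta C).
Implicit Types (x y : A) (al be : part n) (s : 'S_n).

Lemma galg_op_is_semilinear al : semilinear (@galg_op C n al).
Proof.
split=> [k x|x y]; rewrite /galg_op.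
  by rewrite scaler_sumr; apply: eq_bigr => s _; rewrite galgZ scalerA.
by rewrite -big_split; apply: eq_bigr => s _; rewrite galgD scalerDl.
Qed.

HB.instance Definition _ al := GRing.isSemilinear.Build C A 'M[C]_(specht_dim C al) _
  (@galg_op C n al) (galg_op_is_semilinear al).

Lemma galg_op_sum al I (r : seq I) P (F : I -> A) :
  galg_op al (\sum_(i <- r | P i) F i) = \sum_(i <- r | P i) galg_op al (F i).
Proof. exact: linear_sum. Qed.

Lemma galg_opZ al k x : galg_op al (k *: x) = k *: galg_op al x.
Proof. exact: linearZ. Qed.

Lemma galg_op_delta al s : galg_op al (d s) = specht C al s.
Proof.
rewrite /galg_op (bigD1 s) //= ffunE eqxx scale1r big1 ?addr0 // => t /negPf ts.
by rewrite ffunE ts scale0r.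
Qed.

Lemma galg_opM al x y : galg_op al (x * y) = galg_op al x *m galg_op al y.
Proof.
rewrite {1}[x]galg_delta {1}[y]galg_delta mulr_suml linear_sum /= mulmx_suml.
apply: eq_bigr => s _; rewrite mulr_sumr linear_sum /= mulmx_sumr.
apply: eq_bigr => t _; rewrite -scalerAl -scalerAr !linearZ /= gdeltaM.
by rewrite !galg_op_delta repr_mxM ?inE // -scalemxAl !scalerA mulrC.
Qed.

Lemma galg_op_star al x : galg_op al (gstar x) = (galg_op al x) ^t*.
Proof.
rewrite /galg_op (reindex_inj invg_inj) linear_sum map_mx_sum.
apply: eq_bigr => s _; rewrite ffunE invgK specht_inv linearZ /=.
by apply/matrixP => i j; rewrite !mxE rmorphM.
Qed.

Lemma tr_galg_op al x s : \tr (galg_op al x *m specht C al s^-1%g) =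
  \sum_t x t * chi C al (t * s^-1)%g.
Proof.
rewrite /galg_op mulmx_suml linear_sum /=; apply: eq_bigr => t _.
by rewrite -scalemxAl linearZ /= /chi repr_mxM ?inE.
Qed.

(** The regular character, applied to x s^-1, isolates the coefficient of x at s. *)
Lemma galg_inversion x s : (n`!)%:R * x s =
  \sum_al (specht_dim C al)%:R * \tr (galg_op al x *m specht C al s^-1%g).
Proof.
under eq_bigr do rewrite tr_galg_op big_distrr /=.
rewrite exchange_big /= (bigD1 s) //= [X in _ + X]big1 ?addr0 => [|t ts].
  under eq_bigr do rewrite mulrCA.
  by rewrite -big_distrr /= sum_dim_chi mulgV eqxx mulr1 mulrC.
under eq_bigr do rewrite mulrCA; rewrite -big_distrr /= sum_dim_chi.
by rewrite -(inj_eq (mulIg s)) mulgKV mul1g (negPf ts) !mulr0.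
Qed.

Lemma galg_op_inj x y : (forall al, galg_op al x = galg_op al y) -> x = y.
Proof.
move=> e; apply/ffunP => s; apply: (mulfI (fact_neq0 C n)); rewrite !galg_inversion.
by apply: eq_bigr => al _; rewrite e.
Qed.

(* Fourier inversion. *)
Definition galg_block al (M : 'M[C]_(specht_dim C al)) : A :=
  [ffun s => (specht_dim C al)%:R / (n`!)%:R * \tr (M *m specht C al s^-1%g)].

(** The coefficients of a block element are matrix coefficients, so its action is expressed by
    averages of elementary matrices, to which Schur's lemma applies. *)
Let block_entry al be (M : 'M[C]_(specht_dim C al)) k l :
  galg_op be (galg_block M) k l =
  (specht_dim C al)%:R * \sum_i \sum_j
     M i j * average (specht C al) (specht C be) (delta_mx i k) j l.
Proof.
rewrite /galg_op summxE big_distrr /=.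
under [RHS]eq_bigr do rewrite big_distrr /=.
under eq_bigr => s _.
  rewrite mxE ffunE /mxtrace big_distrr big_distrl /=.
  under eq_bigr do rewrite mxE big_distrr big_distrl /=.
  over.
rewrite exchange_big; apply: eq_bigr => i _ /=.
rewrite exchange_big; apply: eq_bigr => j _ /=.
rewrite mxE summxE !big_distrr; apply: eq_bigr => s _ /=.
by rewrite mul_delta_entry -!mulrA; congr (_ * _); rewrite mulrCA.
Qed.

Let r1 al : specht C al 1%g = 1%:M. Proof. exact: repr_mx1. Qed.
Let rM al s t : specht C al (s * t)%g = specht C al s *m specht C al t.
Proof. by rewrite repr_mxM ?inE. Qed.

Lemma galg_op_block_neq al be (M : 'M[C]_(specht_dim C al)) : al != be ->
  galg_op be (galg_block M) = 0.
Proof.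
move=> ab; apply/matrixP => k l; rewrite block_entry big1 ?mulr0 ?mxE // => i _.
rewrite big1 // => j _; rewrite (specht_schur ab (average_intertwines (rM _) (rM _) _)) //.
by rewrite mxE mulr0.
Qed.

Lemma galg_op_block al (M : 'M[C]_(specht_dim C al)) : galg_op al (galg_block M) = M.
Proof.
have d0 : (specht_dim C al)%:R != 0 :> C by rewrite pnatr_eq0 -lt0n chi_gt0.
have av i k j l : average (specht C al) (specht C al) (delta_mx i k) j l =
    ((i == k) && (j == l))%:R / (specht_dim C al)%:R.
  rewrite (specht_schur_scalar (average_intertwines (rM _) (rM _) _)) // mxE.
  have -> : \tr (average (specht C al) (specht C al) (delta_mx i k)) = (i == k)%:R.
    rewrite /average linearZ linear_sum /=.
    rewrite (eq_bigr (fun=> (i == k)%:R)) => [|s _].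
      by rewrite sumr_const card_Sn -[X in _ * X]mulr_natl mulrA mulVf ?mul1r ?fact_neq0.
    rewrite mxtrace_mulC mulmxA -rM mulgV r1 mul1mx /mxtrace (bigD1 i) //= big1 => [|u ui].
      by rewrite mxE eqxx addr0.
    by rewrite mxE (negPf ui).
  by case: (j == l); rewrite ?andbT ?andbF ?mulr1n ?mulr0n ?mul0r.
apply/matrixP => k l; rewrite block_entry (bigD1 k) //= [X in _ + X]big1 => [|i ik].
  rewrite (bigD1 l) //= big1 => [|j jl]; last by rewrite av (negPf jl) andbF mul0r mulr0.
  by rewrite av !eqxx !addr0 mul1r mulrCA divff ?mulr1.
by rewrite big1 // => j _; rewrite av (negPf ik) mul0r mulr0.
Qed.

(** The element with coefficients phi(t^-1) is central, hence acts on each S^mu by a scalar;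
    inverting the Fourier transform expands phi in characters. *)
Lemma class_function_expand (phi : 'S_n -> C) :
    (forall s t, phi (s ^ t)%g = phi s) ->
  forall s, (n`!)%:R * phi s =
    \sum_mu (\sum_t chi C mu t^-1%g * phi t) * chi C mu s.
Proof.
move=> phiJ s; pose F : A := [ffun t => phi t^-1%g].
have FC t : F * d t = d t * F.
  apply/ffunP => g; rewrite mulr_gdelta mul_gdelta !ffunE !invMg !invgK.
  by rewrite -(phiJ _ t) conjgE !mulgA mulVg mul1g.
have opF mu : galg_op mu F =
    ((\sum_t chi C mu t^-1%g * phi t) / (specht_dim C mu)%:R)%:M.
  have i : intertwines (specht C mu) (specht C mu) (galg_op mu F).
    by move=> t; rewrite -galg_op_delta -!galg_opM FC.
  rewrite (specht_schur_scalar i); congr (_ / _)%:M.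
  have := tr_galg_op mu F 1%g; rewrite invg1 r1 mulmx1 => ->.
  rewrite (reindex_inj invg_inj); apply: eq_bigr => t _ /=.
  by rewrite ffunE invgK mulg1 mulrC.
have := galg_inversion F s^-1%g; rewrite ffunE !invgK => ->.
apply: eq_bigr => mu _; rewrite opF mul_scalar_mx linearZ /= mulrA mulrCA.
by rewrite divff ?mulr1 // pnatr_eq0 -lt0n chi_gt0.
Qed.

End GalgOp.

(** * Restriction in stages *)

Section MultiplicityRecursion.
Variable C : numClosedFieldType.

Lemma mult_char_id n (nn : (n <= n)%N) (al be : part n) :
  mult_char C nn al be = (al == be)%:R.
Proof.
rewrite /mult_char -gtr_young; congr gtr; rewrite -[RHS]galg_map_id.
by apply: eq_bigr => s _; rewrite emb_id.
Qed.

Lemma chi_branching n (al : part n.+1) (s : 'S_n) :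
  chi C al (emb (leqnSn n) s) = \sum_(mu : part n) (covers al mu)%:R * chi C mu s.
Proof.
apply: (mulfI (fact_neq0 C n)).
rewrite (class_function_expand (phi := fun s => chi C al (emb (leqnSn n) s))) => [|t g].
  rewrite big_distrr; apply: eq_bigr => mu _ /=.
  by rewrite mult_char_pairing branching mulrA.
rewrite !conjgE !embM (iotaV (@embM _ _ _)) -conjgE; exact: chi_conj.
Qed.

(** Restrict from S_(n+1) to S_n by the branching rule, then to S_m. The result is the recursion
    satisfied by [nb_skew_syt]. *)
Lemma mult_char_recursion m n (mn : (m <= n)%N) (mSn : (m <= n.+1)%N)
    (al : part n.+1) (ga : part m) :
  mult_char C mSn al ga = \sum_(mu : part n) (covers al mu)%:R * mult_char C mn mu ga.
Proof.
apply: (mulfI (fact_neq0 C m)); rewrite -mult_char_pairing big_distrr /=.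
under [RHS]eq_bigr do rewrite mulrCA -mult_char_pairing big_distrr /=.
rewrite exchange_big; apply: eq_bigr => s _ /=.
rewrite -(emb_emb mn (leqnSn n) mSn) chi_branching big_distrr /=.
by apply: eq_bigr => mu _; rewrite mulrCA.
Qed.

End MultiplicityRecursion.

(** * Multiplicity spaces *)

Lemma sum_perm_lshift p q (s : 'S_p) (t : 'S_q) i :
  sum_perm s t (lshift q i) = lshift q (s i).
Proof. by rewrite permE /sum_perm_fun (unsplitK (inl i)). Qed.

Lemma sum_perm_rshift p q (s : 'S_p) (t : 'S_q) j :
  sum_perm s t (rshift p j) = rshift p (t j).
Proof. by rewrite permE /sum_perm_fun (unsplitK (inr j)). Qed.

Lemma sum_permM p q (s s' : 'S_p) (t t' : 'S_q) :
  sum_perm (s * s')%g (t * t')%g = (sum_perm s t * sum_perm s' t')%g.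
Proof.
apply/permP => x; rewrite permM; case: (split_ordP x) => i ->.
  by rewrite !sum_perm_lshift permM.
by rewrite !sum_perm_rshift permM.
Qed.

Lemma unmarked_permE k n (kn : (k <= n)%N) (s : 'S_(n - k)) :
  unmarked_perm kn s = emb (leq_subr k n) s.
Proof.
apply/permP => x; have -> : x = cast_ord (subnK kn) (cast_ord (esym (subnK kn)) x).
  by rewrite cast_ordKV.
rewrite -cast_ord_permE; move: (cast_ord (esym _) x) => y; case: (split_ordP y) => i ->.
  rewrite sum_perm_lshift.
  have e j : cast_ord (subnK kn) (lshift k j) = widen_ord (leq_subr k n) j.
    exact: val_inj.
  by rewrite !e emb_widen.
by rewrite sum_perm_rshift perm1 emb_ge //= leq_addr.
Qed.

Section MultSpace.
Variables (C : numClosedFieldType) (k n : nat) (kn : (k <= n)%N).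
Implicit Types (al : part n) (ga : part (n - k)).
Local Notation iota := (emb (leq_subr k n)).

Lemma mult_spP al ga (phi : 'M[C]_(specht_dim C ga, specht_dim C al)) :
  phi \in mult_sp C kn al ga <->
  intertwines (specht C ga) (fun s => specht C al (iota s)) phi.
Proof.
rewrite memvE /mult_sp; split=> [/subv_bigcapP h s|h].
  have := h s isT; rewrite -memvE memv_ker !lfun_simp /= unmarked_permE subr_eq0.
  by move/eqP.
apply/subv_bigcapP => s _; rewrite -memvE memv_ker !lfun_simp /= unmarked_permE.
by rewrite subr_eq0; apply/eqP/h.
Qed.

Lemma mult_char_nb_skew_syt m l (ml : (m <= l)%N) (al : part l) (ga : part m) :
  mult_char C ml al ga = (nb_skew_syt al ga)%:R.
Proof.
elim: l ml al => [|l IH] ml al.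
  have m0 : m = 0%N by apply/eqP; rewrite -leqn0.
  by subst m; rewrite mult_char_id nb_skew_syt_id.
have [mSl|] := leqP m l.
  rewrite (mult_char_recursion C mSl) (nb_skew_syt_rec _ _ mSl) natr_sum.
  by apply: eq_bigr => mu _; rewrite natrM IH.
move=> lm; have e : m = l.+1 by apply/eqP; rewrite eqn_leq ml lm.
by subst m; rewrite mult_char_id nb_skew_syt_id.
Qed.

Lemma dim_mult_sp al ga : \dim (mult_sp C kn al ga) = nb_skew_syt al ga.
Proof.
apply/eqP; rewrite -(eqr_nat C) -(mult_char_nb_skew_syt (leq_subr k n)).
by apply/eqP/dim_intertwiners => phi; apply: mult_spP.
Qed.

Lemma nb_skew_syt_fact al ga : (nb_skew_syt al ga <= k`!)%N.
Proof.
have := nb_skew_syt_le al ga (leq_subr k n).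
by rewrite subKn.
Qed.

End MultSpace.

(** * Compression by averaging *)

Section Psd.
Variable C : numClosedFieldType.

Lemma conj_mulmx a b c (M : 'M[C]_(a, b)) (N : 'M[C]_(b, c)) :
  (M *m N) ^t* = N ^t* *m M ^t*.
Proof. by rewrite trmx_mul map_mxM. Qed.

Lemma gram_diag_ge0 a b (M : 'M[C]_(a, b)) i : 0 <= (M *m M ^t*) i i.
Proof.
by rewrite mxE; apply: sumr_ge0 => j _; rewrite !mxE mul_conjC_ge0.
Qed.

Lemma gram_trace_ge0 a b (M : 'M[C]_(a, b)) : 0 <= \tr (M *m M ^t*).
Proof. by apply: sumr_ge0 => i _; apply: gram_diag_ge0. Qed.

Lemma gram_trace_eq0 a b (M : 'M[C]_(a, b)) : \tr (M *m M ^t*) = 0 -> M = 0.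
Proof.
move=> /eqP; rewrite psumr_eq0 => [/allP z|i _]; last exact: gram_diag_ge0.
apply/matrixP => i j; have := z i (mem_index_enum _); rewrite /= mxE psumr_eq0.
  by move=> /allP /(_ j (mem_index_enum _)); rewrite /= !mxE mul_conjC_eq0 => /eqP.
by move=> l _; rewrite !mxE mul_conjC_ge0.
Qed.

(** Blocks of algebra elements are square, while Gram factors arise rectangular. The spectral
    theorem supplies a square factor, the eigenvalues being diagonal entries of a Gram matrix. *)
Lemma gram_square a b (N : 'M[C]_(a, b)) :
  exists B : 'M[C]_a, N *m N ^t* = B *m B ^t*.
Proof.
set M := N *m N ^t*; have MH : M ^t* = M by rewrite conj_mulmx trmxCK.
have /orthomx_spectralP : M \is normalmx by apply/normalmxP; rewrite MH.
set P := spectralmx M; set D := spectral_diag M => eM.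
have PU : P \is unitarymx := spectral_unitarymx M.
have PP := unitarymxP PU; rewrite (invmx_unitary PU) in eM.
have De : diag_mx D = (P *m N) *m (P *m N) ^t*.
  rewrite conj_mulmx mulmxA -(mulmxA P) -/M eM !mulmxA PP mul1mx -mulmxA PP.
  by rewrite mulmx1.
have D0 i : 0 <= D 0 i.
  by have := gram_diag_ge0 (P *m N) i; rewrite -De mxE eqxx.
pose S := diag_mx (\row_i sqrtC (D 0 i)).
exists (P ^t* *m S); rewrite conj_mulmx trmxCK eM mulmxA -(mulmxA _ S).
congr (_ *m _ *m _); rewrite /S tr_diag_mx map_diag_mx mulmx_diag.
congr diag_mx; apply/rowP => i; rewrite !mxE.
rewrite -[LHS]sqrtCK expr2; congr (_ * _); apply/esym/conj_Creal.
by rewrite ger0_real ?sqrtC_ge0.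
Qed.

(** Square factors of all blocks are assembled by Fourier inversion into a single algebra
    element. *)
Lemma gpos_blocks n (x : galg C n) :
  (forall al : part n, exists b (N : 'M[C]_(specht_dim C al, b)),
     galg_op al x = N *m N ^t*) -> gpos x.
Proof.
move=> xN; have /fin_all_exists [B BE] : forall al : part n,
    exists B : 'M[C]_(specht_dim C al), galg_op al x = B *m B ^t*.
  by move=> al; have [b [N ->]] := xN al; apply: gram_square.
exists (\sum_al galg_block (B al)); apply: galg_op_inj => al.
rewrite [gmul _ _]/(_ * gstar _) galg_opM galg_op_star.
suff -> : galg_op al (\sum_be galg_block (B be)) = B al by [].
rewrite linear_sum (bigD1 al) //= galg_op_block big1 ?addr0 // => be ne.
exact: galg_op_block_neq.
Qed.

End Psd.

Section Twirl.
Variables (C : numClosedFieldType) (k n : nat) (kn : (k <= n)%N).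
Local Notation d := (gdelta C).
Local Notation iota := (emb (leq_subr k n)).
Implicit Types (X : galg C n) (al : part n) (ga : part (n - k)).

Let iM := @embM _ _ (leq_subr k n).

Definition twirl X : galg C n :=
  ((n - k)`!)%:R^-1 *: \sum_s d (iota s^-1%g) * X * d (iota s).

Lemma twirl_comm X s : twirl X * d (iota s) = d (iota s) * twirl X.
Proof.
rewrite /twirl -scalerAl -scalerAr mulr_suml mulr_sumr; congr (_ *: _).
rewrite [RHS](reindex_inj (mulIg s)); apply: eq_bigr => t _ /=.
rewrite invMg !iM -!gdeltaM !mulrA gdeltaM -iM mulgV (iota1 iM) gdelta1.
by rewrite mul1r.
Qed.

Lemma galg_op_twirl al X : galg_op al (twirl X) = ((n - k)`!)%:R^-1 *:
  \sum_s specht C al (iota s) ^t* *m galg_op al X *m specht C al (iota s).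
Proof.
have e s : galg_op al (d (iota s^-1%g) * X * d (iota s)) =
    specht C al (iota s) ^t* *m galg_op al X *m specht C al (iota s).
  by rewrite !galg_opM !galg_op_delta (iotaV iM) specht_inv.
by rewrite /twirl linearZ linear_sum; congr (_ *: _); apply: eq_bigr => s _; apply: e.
Qed.

Lemma row_mx_gram a b c (M : 'M[C]_(a, b)) (N : 'M[C]_(a, c)) :
  row_mx M N *m (row_mx M N) ^t* = M *m M ^t* + N *m N ^t*.
Proof. by rewrite tr_row_mx map_col_mx mul_row_col. Qed.

(** The factors are placed side by side, which is why rectangular ones are allowed. *)
Lemma gram_sum a I (r : seq I) (F : I -> 'M[C]_a) :
  (forall i, exists b (N : 'M[C]_(a, b)), F i = N *m N ^t*) ->
  exists b (N : 'M[C]_(a, b)), \sum_(i <- r) F i = N *m N ^t*.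
Proof.
move=> FN; elim: r => [|i r [b [N e]]].
  by exists 0%N, 0; rewrite big_nil mul0mx.
have [b' [N' e']] := FN i; exists (b' + b)%N, (row_mx N' N).
by rewrite big_cons e e' row_mx_gram.
Qed.

Lemma gpos_op X al : gpos X ->
  exists N : 'M[C]_(specht_dim C al), galg_op al X = N *m N ^t*.
Proof.
move=> [a ->]; exists (galg_op al a).
by rewrite [gmul _ _]/(a * gstar a) galg_opM galg_op_star.
Qed.

Lemma gram_scale a b (N : 'M[C]_(a, b)) c : 0 <= c ->
  exists N' : 'M[C]_(a, b), c *: (N *m N ^t*) = N' *m N' ^t*.
Proof.
move=> c0; exists (sqrtC c *: N); rewrite linearZ map_mxZ /=.
rewrite -scalemxAl -scalemxAr scalerA conj_Creal ?ger0_real ?sqrtC_ge0 //.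
by rewrite -expr2 sqrtCK.
Qed.

Lemma gpos_twirl X : gpos X -> gpos (twirl X).
Proof.
move=> Xp; apply: gpos_blocks => al; have [N eN] := gpos_op al Xp.
rewrite galg_op_twirl scaler_sumr; apply: gram_sum => s.
exists (specht_dim C al).
have -> : specht C al (iota s) ^t* *m galg_op al X *m specht C al (iota s) =
    (specht C al (iota s) ^t* *m N) *m (specht C al (iota s) ^t* *m N) ^t*.
  by rewrite eN conj_mulmx trmxCK !mulmxA.
by apply: gram_scale; rewrite invr_ge0 ler0n.
Qed.

Section Blocks.
Variable X : galg C n.
Hypothesis XC : forall s, X * d (iota s) = d (iota s) * X.

Lemma galg_op_mult_sp al ga (phi : 'M[C]_(specht_dim C ga, specht_dim C al)) :
  phi \in mult_sp C kn al ga -> phi *m galg_op al X \in mult_sp C kn al ga.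
Proof.
move=> /mult_spP i; apply/mult_spP => s.
have e : specht C al (iota s) *m galg_op al X = galg_op al X *m specht C al (iota s).
  by rewrite -!galg_op_delta -!galg_opM XC.
by rewrite mulmxA i -[LHS]mulmxA -[RHS]mulmxA e.
Qed.

Definition block_fun al ga (phi : mult C kn al ga) : mult C kn al ga :=
  vsproj _ (vsval phi *m galg_op al X).

Lemma block_fun_is_semilinear al ga : semilinear (@block_fun al ga).
Proof.
split=> [c x|x y]; rewrite /block_fun.
  by rewrite linearZ /= -scalemxAl linearZ.
by rewrite linearD /= mulmxDl linearD.
Qed.

HB.instance Definition _ al ga := GRing.isSemilinear.Build C
  (mult C kn al ga) (mult C kn al ga) _ (@block_fun al ga)
  (block_fun_is_semilinear al ga).

Definition blocks : mult_blocks C kn := fun al ga => linfun (@block_fun al ga).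

Lemma blocksE al ga phi : vsval (blocks al ga phi) = vsval phi *m galg_op al X.
Proof.
by rewrite /blocks lfunE /= /block_fun vsprojK // galg_op_mult_sp // subvsP.
Qed.

Lemma blocks_form : gpos X -> block_form X blocks.
Proof.
move=> Xp; split=> [al ga phi v|al ga phi]; first by rewrite blocksE mulmxA.
have [N eN] := gpos_op al Xp; rewrite /mult_form blocksE eN mulmxA -mulmxA.
by rewrite -conj_mulmx gram_trace_ge0.
Qed.

End Blocks.

Lemma compressed_twirl X : gpos X -> compressed kn (twirl X).
Proof.
move=> Xp; split; first exact: gpos_twirl.
exists (blocks (twirl X)); apply: blocks_form; last exact: gpos_twirl.
by move=> s; apply: twirl_comm.
Qed.

(** ** Rank one pieces *)

Section RankOne.
Variables (al : part n) (ga : part (n - k)).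
Variable phi : 'M[C]_(specht_dim C ga, specht_dim C al).
Hypothesis phiM : phi \in mult_sp C kn al ga.

Let R1 : galg C n := galg_block (phi ^t* *m phi).

Let R1_comm s : R1 * d (iota s) = d (iota s) * R1.
Proof.
have ip := (mult_spP kn phi).1 phiM.
apply: galg_op_inj => be; rewrite !galg_opM galg_op_delta.
have [<-|ne] := eqVneq al be; last by rewrite galg_op_block_neq // mul0mx mulmx0.
rewrite galg_op_block -mulmxA -ip.
have -> : specht C al (iota s) = (specht C al (iota s^-1%g)) ^t*.
  by rewrite -specht_inv -(iotaV iM) invgK.
by rewrite [RHS]mulmxA -conj_mulmx -ip conj_mulmx -specht_inv invgK [LHS]mulmxA.
Qed.

Lemma rank_one_piece : phi != 0 -> rank_one_compressed kn al ga R1.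
Proof.
move=> phi0; have Rp : gpos R1.
  apply: gpos_blocks => be; have [<-|ne] := eqVneq al be.
    by exists (specht_dim C ga), (phi ^t*); rewrite galg_op_block trmxCK.
  by exists 0%N, 0; rewrite galg_op_block_neq // mul0mx.
(* The adjoint of [phi] intertwines in the opposite direction, so this product maps S^ga' to S^ga
   equivariantly: it vanishes for ga' different from [ga] and is a scalar otherwise. *)
have schur ga' (psi : 'M[C]_(specht_dim C ga', specht_dim C al)) :
    psi \in mult_sp C kn al ga' -> intertwines (specht C ga') (specht C ga) (psi *m phi ^t*).
  move=> /mult_spP ips s; have ip := (mult_spP kn phi).1 phiM s^-1%g.
  rewrite mulmxA ips -mulmxA -[RHS]mulmxA; congr (_ *m _).
  by rewrite -[specht C ga s]trmxCK -specht_inv -conj_mulmx ip conj_mulmx -specht_inv -(iotaV iM) invgK.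
split=> //; exists (blocks R1); split; first exact: blocks_form.
  move=> al' ga' ne; apply/lfunP => psi; apply: val_inj.
  rewrite [LHS](blocksE R1_comm) zero_lfunE /=.
  case: (eqVneq al al') ne psi => [<-|na] ne psi; last by rewrite galg_op_block_neq // mulmx0.
  rewrite galg_op_block mulmxA.
  rewrite (specht_schur _ (schur _ _ (subvsP psi))) ?mul0mx //.
  by apply: contra_neq ne => ->.
pose Phi : mult C kn al ga := vsproj _ phi.
have PhiE : vsval Phi = phi by rewrite vsprojK.
have BE (psi : mult C kn al ga) : blocks R1 al ga psi =
    (\tr (vsval psi *m phi ^t*) / (specht_dim C ga)%:R) *: Phi.
  apply: val_inj; rewrite [LHS](blocksE R1_comm) [RHS]/= PhiE.
  rewrite galg_op_block mulmxA {1}(specht_schur_scalar (schur _ _ (subvsP psi))).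
  by rewrite mul_scalar_mx.
suff -> : limg (blocks R1 al ga) = <[Phi]>%VS.
  rewrite dim_vline -(inj_eq val_inj) /= PhiE.
  by rewrite phi0.
apply/eqP; rewrite eqEsubv; apply/andP; split.
  apply/subvP => _ /memv_imgP [psi _ ->]; rewrite BE.
  by apply/vlineP; exists (\tr (vsval psi *m phi ^t*) / (specht_dim C ga)%:R).
(* c is the scalar by which the piece acts on [phi] itself. It is nonzero because the trace of a
   nonzero Gram matrix is, so the image is the whole line. *)
rewrite -memvE; pose c := \tr (phi *m phi ^t*) / (specht_dim C ga)%:R.
have c0 : c != 0.
  rewrite mulf_neq0 ?invr_eq0 ?pnatr_eq0 -?lt0n ?chi_gt0 //.
  by apply: contra_neq phi0; apply: gram_trace_eq0.
have -> : Phi = blocks R1 al ga (c^-1 *: Phi).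
  by rewrite linearZ /= BE PhiE -/c scalerA mulVf // scale1r.
by rewrite memv_img ?memvf.
Qed.

End RankOne.

End Twirl.

(** * The partial swap *)

Section Swap.
Variables (C : numClosedFieldType) (k p q : nat).
Hypotheses (kp : (k <= p)%N) (kq : (k <= q)%N).
Local Notation d := (gdelta C).
Local Notation left s := (@sum_perm p q s 1%g).
Local Notation right t := (@sum_perm p q 1%g t).
Local Notation mapl := (galg_map (fun s : 'S_p => left s)).
Local Notation mapr := (galg_map (fun t : 'S_q => right t)).
Local Notation tau := (partial_swap kp kq).
Implicit Types (X : galg C p) (Y : galg C q).

Lemma leftM s s' : left (s * s')%g = (left s * left s')%g.
Proof. by rewrite -sum_permM mul1g. Qed.

Lemma rightM t t' : right (t * t')%g = (right t * right t')%g.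
Proof. by rewrite -sum_permM mul1g. Qed.

Lemma left_right s t : (left s * right t = right t * left s)%g.
Proof. by rewrite -!sum_permM !mul1g !mulg1. Qed.

Lemma gtensE X Y : gtens X Y = mapl X * mapr Y.
Proof.
apply/ffunP => g; rewrite ffunE mulr_suml galg_sum.
rewrite -(pair_big_dep predT (fun s t => sum_perm s t == g) (fun s t => X s * Y t)) /=.
apply: eq_bigr => s _; rewrite mulr_sumr galg_sum big_mkcond; apply: eq_bigr => t _.
rewrite -scalerAr -scalerAl gdeltaM -sum_permM mul1g mulg1 !galgZ ffunE eq_sym.
by case: eqP => _; rewrite ?mulr1 ?mulr0 // mulrC.
Qed.

Lemma mapl_comm s Y : d (left s) * mapr Y = mapr Y * d (left s).
Proof.
rewrite mulr_sumr mulr_suml; apply: eq_bigr => t _.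
by rewrite -scalerAr -scalerAl !gdeltaM left_right.
Qed.

Lemma mapr_comm t X : d (right t) * mapl X = mapl X * d (right t).
Proof.
rewrite mulr_sumr mulr_suml; apply: eq_bigr => s _.
by rewrite -scalerAr -scalerAl !gdeltaM left_right.
Qed.

(** Conjugation by g relabels each transposition by the images of its two marked points, which g
    fixes. *)
Lemma partial_swapJ (g : 'S_(p + q)) :
    (forall i : 'I_k, g (lshift q (marked kp i)) = lshift q (marked kp i)) ->
    (forall i : 'I_k, g (rshift p (marked kq i)) = rshift p (marked kq i)) ->
  (g * tau = tau * g)%g.
Proof.
move=> gl gr; rewrite [RHS]conjgC; congr (_ * _)%g.
rewrite /partial_swap (big_morph (conjg^~ g) (fun x y => conjMg x y g) (conj1g g)).
by apply: eq_bigr => i _; rewrite tpermJ gl gr.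
Qed.

Let markedl s i : emb (leq_subr k p) s (marked kp i) = marked kp i.
Proof. by rewrite emb_ge //= leq_addr. Qed.

Let markedr s i : emb (leq_subr k q) s (marked kq i) = marked kq i.
Proof. by rewrite emb_ge //= leq_addr. Qed.

Lemma swap_coefE X Y nu :
  swap_coef kp kq X Y nu = \tr (galg_op nu (d tau * (mapl X * mapr Y))).
Proof. by rewrite /swap_coef gtensE. Qed.

Lemma tr_galg_opC n (nu : part n) (x y : galg C n) :
  \tr (galg_op nu (x * y)) = \tr (galg_op nu (y * x)).
Proof. by rewrite !galg_opM mxtrace_mulC. Qed.

Lemma swap_coef_suml I (r : seq I) (c : I -> C) (Z : I -> galg C p) Y nu :
  swap_coef kp kq (\sum_(i <- r) c i *: Z i) Y nu =
  \sum_(i <- r) c i * swap_coef kp kq (Z i) Y nu.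
Proof.
rewrite swap_coefE galg_map_sum mulr_suml mulr_sumr galg_op_sum linear_sum.
apply: eq_bigr => i _; rewrite swap_coefE galg_mapZ -scalerAl -scalerAr.
by rewrite galg_opZ [LHS]linearZ.
Qed.

Lemma swap_coef_sumr I (r : seq I) (c : I -> C) (Z : I -> galg C q) X nu :
  swap_coef kp kq X (\sum_(i <- r) c i *: Z i) nu =
  \sum_(i <- r) c i * swap_coef kp kq X (Z i) nu.
Proof.
rewrite swap_coefE galg_map_sum !mulr_sumr galg_op_sum linear_sum.
apply: eq_bigr => i _; rewrite swap_coefE galg_mapZ -!scalerAr.
by rewrite galg_opZ [LHS]linearZ.
Qed.

Lemma swap_coef_twirll X Y nu :
  swap_coef kp kq (twirl k X) Y nu = swap_coef kp kq X Y nu.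
Proof.
rewrite /twirl scaler_sumr swap_coef_suml -big_distrr /=.
rewrite (eq_bigr (fun=> swap_coef kp kq X Y nu)) => [|s _].
  by rewrite sumr_const card_Sn -[X in _ * X]mulr_natl mulrA mulVf ?mul1r ?fact_neq0.
set g := emb _ s; rewrite !swap_coefE !(galg_mapM leftM) !galg_map_delta.
rewrite (iotaV (@embM _ _ _)) -/g (iotaV leftM).
(* The trailing l passes Y, moves cyclically to the front of the trace, and passes tau to cancel
   l^-1. *)
set l := left g; rewrite -!mulrA mapl_comm !mulrA tr_galg_opC !mulrA gdeltaM.
have -> : (l * tau = tau * l)%g.
  by apply: partial_swapJ => i; rewrite /l ?sum_perm_lshift ?sum_perm_rshift ?perm1 ?markedl.
by rewrite gdeltaM mulgK.
Qed.

Lemma swap_coef_twirlr X Y nu :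
  swap_coef kp kq X (twirl k Y) nu = swap_coef kp kq X Y nu.
Proof.
rewrite /twirl scaler_sumr swap_coef_sumr -big_distrr /=.
rewrite (eq_bigr (fun=> swap_coef kp kq X Y nu)) => [|s _].
  by rewrite sumr_const card_Sn -[X in _ * X]mulr_natl mulrA mulVf ?mul1r ?fact_neq0.
set g := emb _ s; rewrite !swap_coefE !(galg_mapM rightM) !galg_map_delta.
rewrite (iotaV (@embM _ _ _)) -/g (iotaV rightM).
set l := right g; have lV : d l^-1%g * mapl X = mapl X * d l^-1%g.
  by rewrite -(iotaV rightM) mapr_comm.
rewrite !mulrA -(mulrA _ (mapl X)) -lV !mulrA tr_galg_opC !mulrA gdeltaM.
have -> : (l * tau = tau * l)%g.
  by apply: partial_swapJ => i; rewrite /l ?sum_perm_lshift ?sum_perm_rshift ?perm1 ?markedr.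
by rewrite gdeltaM mulgK.
Qed.

End Swap.

(** * Decomposition into rank one pieces *)

Section Cone.
Variables (C : numClosedFieldType) (T : Type).
Implicit Types (A B : (T -> C) -> Prop) (v w : T -> C).

Lemma cone_gen_in A v c : 0 <= c -> A v -> cone_gen A (fun t => c * v t).
Proof.
move=> c0 Av; exists 1%N, (fun=> c), (fun=> v); split=> // t.
by rewrite big_ord1.
Qed.

Lemma cone_gen_sum A I (r : seq I) (v : I -> T -> C) w :
    (forall i, cone_gen A (v i)) -> (forall t, w t = \sum_(i <- r) v i t) ->
  cone_gen A w.
Proof.
move=> Av; elim: r w => [|i r IH] w wE.
  exists 0%N, (fun=> 0), (fun=> w); split=> [[]//|t].
  by rewrite wE big_nil big_ord0.
have [m [c [u [cu uE]]]] := Av i.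
have [m' [c' [u' [cu' uE']]]] := IH (fun t => \sum_(i <- r) v i t) (fun=> erefl).
exists (m + m')%N, (fun j => match split j with inl a => c a | inr a => c' a end),
  (fun j => match split j with inl a => u a | inr a => u' a end).
split=> [j|t]; first by case: (split j).
rewrite wE big_cons uE uE' big_split_ord /=; congr (_ + _); apply: eq_bigr => a _.
  by rewrite (unsplitK (inl a)).
by rewrite (unsplitK (inr a)).
Qed.

Lemma cone_genZ A v c w : 0 <= c -> cone_gen A v -> (forall t, w t = c * v t) ->
  cone_gen A w.
Proof.
move=> c0 [m [d [u [du vE]]]] wE; exists m, (fun i => c * d i), u.
split=> [i|t]; last by rewrite wE vE big_distrr; apply: eq_bigr => i _; rewrite /= mulrA.
by have [d0 Au] := du i; rewrite mulr_ge0.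
Qed.

Lemma cone_gen_sub A B v : (forall w, A w -> cone_gen B w) -> cone_gen A v -> cone_gen B v.
Proof.
move=> AB [m [c [w [cw vE]]]].
apply: (cone_gen_sum (r := index_enum 'I_m) (v := fun i t => c i * w i t)) => // i.
by have [c0 /AB Bw] := cw i; apply: cone_genZ c0 Bw _.
Qed.

End Cone.

(** * Splitting a twirled element *)

Section Decomposition.
Variables (C : numClosedFieldType) (k n : nat) (kn : (k <= n)%N).
Local Notation d := (gdelta C).
Local Notation iota := (emb (leq_subr k n)).
Local Notation rho ga := (specht C (n := n - k) ga).
Local Notation sigma al := (fun s => specht C (n := n) al (iota s)).
Implicit Types (X : galg C n) (al : part n) (ga : part (n - k)).

Let iM := @embM _ _ (leq_subr k n).

(** Averaging makes a basis matrix equivariant; the factor from A is inserted so that the products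
    of a piece with its adjoint rebuild X = A A^* between group elements. *)
Definition piece al ga (A : 'M[C]_(specht_dim C al)) i j :
    'M[C]_(specht_dim C ga, specht_dim C al) :=
  average (rho ga) (sigma al) (delta_mx i j *m A ^t*).

Lemma piece_mult_sp al ga A i j : @piece al ga A i j \in mult_sp C kn al ga.
Proof.
apply/mult_spP; apply: average_intertwines => s t.
  by rewrite repr_mxM ?inE.
by rewrite iM repr_mxM ?inE.
Qed.

Lemma sum_delta_sandwich a b (M : 'M[C]_a) :
  \sum_i \sum_(j < b) delta_mx j i *m M *m delta_mx i j = (\tr M)%:M.
Proof.
apply/matrixP => u v; rewrite summxE !mxE /mxtrace -sumrMnl; apply: eq_bigr => i _.
have e j : (delta_mx j i *m M *m delta_mx i j) u v =
    (u == j)%:R * M i i * (j == v)%:R.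
  have f : (delta_mx j i *m M) u i = (u == j)%:R * M i i.
    by rewrite -[delta_mx j i]mul1mx mul_delta_entry mxE.
  have := mul_delta_entry (delta_mx j i *m M) (1%:M : 'M[C]_b) u i j v.
  by rewrite mulmx1 f [1%:M j v]mxE.
rewrite summxE (eq_bigr _ (fun j _ => e j)) (bigD1 u) //= big1 => [|j ju].
  by rewrite eqxx mul1r addr0 mulr_natr.
by rewrite eq_sym (negPf ju) !mul0r.
Qed.

(* The sum over ga collapses by the regular character of S_(n - k). *)
Lemma sum_pieces al X A : galg_op al X = A *m A ^t* ->
  galg_op al (twirl k X) = \sum_(ga : part (n - k)) (specht_dim C ga)%:R *:
    \sum_i \sum_j (@piece al ga A i j) ^t* *m @piece al ga A i j.
Proof.
move=> XE; pose g : C := ((n - k)`!)%:R^-1.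
pose L t := (sigma al t) ^t* *m A; pose R s := A ^t* *m sigma al s.
have pE ga i j : @piece al ga A i j =
    g *: \sum_s rho ga s^-1%g *m delta_mx i j *m R s.
  by rewrite /piece /average; congr (_ *: _); apply: eq_bigr => s _; rewrite !mulmxA.
have RL t : (R t) ^t* = L t by rewrite /R conj_mulmx trmxCK.
have gr : g^* = g by rewrite /g fmorphV /= rmorph_nat.
have pC ga i j : (@piece al ga A i j) ^t* =
    g *: \sum_t L t *m delta_mx j i *m rho ga t.
  rewrite pE linearZ map_mxZ /= gr linear_sum map_mx_sum; congr (_ *: _).
  apply: eq_bigr => t _; rewrite conj_mulmx RL conj_mulmx -specht_inv invgK.
  by rewrite mulmxA trmx_delta map_delta_mx.
(* Summing over i and j contracts the middle factor to its trace, the character of S^ga at t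
   s^-1. *)
have sE ga : \sum_i \sum_j (@piece al ga A i j) ^t* *m @piece al ga A i j =
    (g * g) *: \sum_t \sum_s chi C ga (t * s^-1)%g *: (L t *m R s).
  transitivity (\sum_i \sum_j (g * g) *: \sum_t \sum_s
      L t *m (delta_mx j i *m rho ga (t * s^-1)%g *m delta_mx i j) *m R s).
    apply: eq_bigr => i _; apply: eq_bigr => j _.
    rewrite pC pE -scalemxAl -scalemxAr scalerA mulmx_suml; congr (_ *: _).
    apply: eq_bigr => t _; rewrite mulmx_sumr; apply: eq_bigr => s _.
    by rewrite repr_mxM ?inE // !mulmxA.
  under eq_bigr do rewrite -scaler_sumr exchange_big /=.
  rewrite -scaler_sumr exchange_big /=; congr (_ *: _); apply: eq_bigr => t _.
  under eq_bigr do rewrite exchange_big /=.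
  rewrite exchange_big /=; apply: eq_bigr => s _.
  under eq_bigr do rewrite -mulmx_suml -mulmx_sumr.
  rewrite -mulmx_suml -mulmx_sumr sum_delta_sandwich.
  by rewrite mul_mx_scalar -scalemxAl.
under eq_bigr do rewrite sE scalerA mulrC -scalerA.
(* One factor g is the normalization of the twirl; the other cancels the (n - k)! of the regular
   character. *)
rewrite galg_op_twirl -scaler_sumr -/g -scalerA; congr (_ *: _).
under [in RHS]eq_bigr do rewrite scaler_sumr.
rewrite exchange_big scaler_sumr; apply: eq_bigr => t _ /=.
under [in RHS]eq_bigr do rewrite scaler_sumr.
rewrite exchange_big (bigD1 t) //= [X in _ + X]big1 => [|s st].
  under [in RHS]eq_bigr do rewrite scalerA.
  rewrite addr0 -scaler_suml sum_dim_chi mulgV eqxx mulr1 scalerA mulVf ?fact_neq0 //.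
  by rewrite scale1r XE !mulmxA.
under eq_bigr do rewrite scalerA.
by rewrite -scaler_suml sum_dim_chi -(inj_eq (mulIg s)) mulgKV mul1g eq_sym (negPf st) mulr0 scale0r.
Qed.

Lemma twirl_decomposition X : gpos X ->
  exists m (c : 'I_m -> C) (Z : 'I_m -> galg C n),
    (forall i, 0 <= c i /\ exists al ga, rank_one_compressed kn al ga (Z i)) /\
    twirl k X = \sum_i c i *: Z i.
Proof.
move=> Xp.
have /fin_all_exists [A AE] : forall al : part n,
    exists A : 'M[C]_(specht_dim C al), galg_op al X = A *m A ^t*.
  by move=> al; apply: gpos_op.
(* Elements are viewed as coefficient functions, so that the closure properties of [cone_gen]
   flatten the fourfold sum into one indexed family. *)
pose R1 : ('S_n -> C) -> Prop := fun w => exists Z : galg C n,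
  (exists al ga, rank_one_compressed kn al ga Z) /\ forall g, w g = Z g.
have XE : twirl k X = \sum_al \sum_(ga : part (n - k)) \sum_i \sum_j
    (specht_dim C ga)%:R *:
    galg_block ((@piece al ga (A al) i j) ^t* *m @piece al ga (A al) i j).
  apply: galg_op_inj => al; rewrite (sum_pieces (AE al)) galg_op_sum.
  rewrite (bigD1 al) //= [X in _ = _ + X]big1 ?addr0 => [|be ne].
    rewrite galg_op_sum; apply: eq_bigr => ga _.
    rewrite galg_op_sum scaler_sumr; apply: eq_bigr => i _.
    rewrite galg_op_sum scaler_sumr; apply: eq_bigr => j _.
    by rewrite galg_opZ galg_op_block.
  rewrite galg_op_sum big1 // => ga _; rewrite galg_op_sum big1 // => i _.
  rewrite galg_op_sum big1 // => j _; rewrite galg_opZ.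
  by rewrite galg_op_block_neq // scaler0.
have : cone_gen R1 (fun g => twirl k X g).
  apply: (cone_gen_sum (r := index_enum (part n)) (v := fun al g =>
    \sum_(ga : part (n - k)) \sum_i \sum_j ((specht_dim C ga)%:R *:
    galg_block ((@piece al ga (A al) i j) ^t* *m @piece al ga (A al) i j)) g)); last first.
    move=> g; rewrite XE galg_sum; apply: eq_bigr => al _.
    rewrite galg_sum; apply: eq_bigr => ga _; rewrite galg_sum; apply: eq_bigr => i _.
    by rewrite galg_sum.
  move=> al; apply: cone_gen_sum (fun=> erefl) => ga.
  apply: cone_gen_sum (fun=> erefl) => i; apply: cone_gen_sum (fun=> erefl) => j.
  rewrite /=; set ph := @piece al ga (A al) i j.
  (* A zero intertwiner gives no rank one block; its term is the empty combination. *)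
  have [->|ph0] := eqVneq ph 0.
    apply: (cone_gen_sum (r := [::]) (I := unit) (v := fun=> fun=> 0)) => [[]|g].
      by exists 0%N, (fun=> 0), (fun=> fun=> 0); split=> [[]//|t]; rewrite big_ord0.
    by rewrite big_nil galgZ ffunE mulmx0 mul0mx linear0 !mulr0.
  apply: (cone_genZ (c := (specht_dim C ga)%:R) (v := fun g => 1 * galg_block (ph ^t* *m ph) g)).
  - exact: ler0n.
  - apply: cone_gen_in => //; exists (galg_block (ph ^t* *m ph)); split=> //.
    by exists al, ga; apply: rank_one_piece ph0; apply: piece_mult_sp.
  - by move=> g; rewrite mul1r galgZ.
case=> m [c [w [cw wE]]].
have /fin_all_exists [Z ZP] : forall i : 'I_m, exists Z : galg C n,
    (exists al ga, rank_one_compressed kn al ga Z) /\ forall g, w i g = Z g.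
  by move=> i; case: (cw i).
exists m, c, Z; split=> [i|]; first by have [c0 _] := cw i; have [R _] := ZP i.
apply/ffunP => g; rewrite wE galg_sum; apply: eq_bigr => i _.
by have [_ ->] := ZP i; rewrite galgZ.
Qed.

End Decomposition.

Theorem theorem9p3 (C : numClosedFieldType) (p q k : nat)
    (p1 : (1 <= p)%N) (q1 : (1 <= q)%N) (k1 : (1 <= k)%N)
    (kp : (k <= p)%N) (kq : (k <= q)%N) :
  [/\ (forall (X : galg C p) (Y : galg C q), gpos X -> gpos Y ->
         exists (X' : galg C p) (Y' : galg C q),
           [/\ compressed kp X', compressed kq Y'
             & forall nu : part (p + q),
                 swap_coef kp kq X' Y' nu = swap_coef kp kq X Y nu]),
      (forall (al : part p) (ga : part (p - k)),
         \dim (mult_sp C kp al ga) = nb_skew_syt al ga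
         /\ (nb_skew_syt al ga <= k`!)%N),
      (forall (be : part q) (de : part (q - k)),
         \dim (mult_sp C kq be de) = nb_skew_syt be de
         /\ (nb_skew_syt be de <= k`!)%N)
    & forall v : part (p + q) -> C,
        cone_gen (fun w => exists (X : galg C p) (Y : galg C q),
          [/\ gpos X, gpos Y & forall nu, w nu = swap_coef kp kq X Y nu]) v
        <->
        cone_gen (fun w => exists (X : galg C p) (Y : galg C q)
            (al : part p) (be : part q) (ga : part (p - k)) (de : part (q - k)),
          [/\ rank_one_compressed kp al ga X, rank_one_compressed kq be de Y
            & forall nu, w nu = swap_coef kp kq X Y nu]) v].
Proof.
split=> [X Y Xp Yp|al ga|be de|v].
- exists (twirl k X), (twirl k Y); split; try exact: compressed_twirl.
  by move=> nu; rewrite swap_coef_twirll swap_coef_twirlr.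
- by split; [apply: dim_mult_sp | apply: nb_skew_syt_fact].
- by split; [apply: dim_mult_sp | apply: nb_skew_syt_fact].
split; apply: cone_gen_sub => w; last first.
  move=> [X [Y [al [be [ga [de [[Xp _] [Yp _] wE]]]]]]].
  apply: (cone_genZ (c := 1) (v := fun nu => 1 * w nu)) => //.
    by apply: cone_gen_in => //; exists X, Y.
  by move=> nu; rewrite !mul1r.
move=> [X [Y [Xp Yp wE]]].
(* Both twirls split into rank one pieces. The coefficient vector is bilinear, so it becomes a
   combination over pairs of pieces with products of nonnegative weights. *)
have [m [c [Z [cZ XE]]]] := twirl_decomposition kp Xp.
have [m' [c' [Z' [cZ' YE]]]] := twirl_decomposition kq Yp.
apply: (cone_gen_sum (r := index_enum ('I_m * 'I_m')%type)
  (v := fun ij nu => c ij.1 * c' ij.2 * swap_coef kp kq (Z ij.1) (Z' ij.2) nu)) => [[i j]|nu].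
  have [c0 [al [ga R]]] := cZ i; have [c0' [be [de R']]] := cZ' j.
  apply: (cone_gen_in (v := swap_coef kp kq (Z i) (Z' j))); first exact: mulr_ge0.
  by exists (Z i), (Z' j), al, be, ga, de.
rewrite wE -(swap_coef_twirll kp kq) -(swap_coef_twirlr kp kq) XE YE swap_coef_suml.
rewrite -(pair_bigA _ (fun i j => c i * c' j * swap_coef kp kq (Z i) (Z' j) nu)) /=.
apply: eq_bigr => i _; rewrite swap_coef_sumr big_distrr; apply: eq_bigr => j _.
by rewrite /= mulrA.
Qed.
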